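(* There exists a polynomial-time algorithm which, given a strongly connected extended semicomplete digraph $D$, decides whether $D$ has a spanning G-cycle and, if so, finds a spanning G-cycle of $D$ containing the maximum number of arcs among all spanning G-cycles of $D$.
   Context: All digraphs are finite, without loops or parallel arcs (2-cycles allowed). A semicomplete digraph is a digraph with at least one arc between every two distinct vertices. A digraph $D$ is an extended semicomplete digraph if there are a semicomplete digraph $S$ on vertex set $\{1,\ldots,s\}$ and integers $n_1,\ldots,n_s\ge1$ such that $D$ is obtained from $S$ by replacing each vertex $i$ by an independent set $I_i$ of $n_i$ vertices and, for every arc $ij$ of $S$, adding all arcs from $I_i$ to $I_j$; the sets $I_i$ are the partite sets of $D$. A G-cycle of $D$ is either a directed cycle of $D$, or a sequence of $r\ge1$ pairwise vertex-disjoint directed paths $P_1,\ldots,P_r$ of $D$ (a path may be a single vertex), $P_i$ from $u_i$ to $v_i$, such that $v_i$ and $u_{i+1}$ lie in the same partite set for every $i\in[r]$, where $u_{r+1}=u_1$. Its number of arcs is the number of arcs of $D$ used by the cycle, resp. by the paths $P_i$. A G-cycle is spanning if it contains all vertices of $D$. *)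

(* Defs.v *)
From mathcomp Require Import all_boot.
Set Implicit Arguments.
Unset Strict Implicit.
Unset Printing Implicit Defensive.

Record digraph (V : finType) := Digraph {
  arc :> rel V;
  arc_irr : irreflexive arc
}.

Definition semicomplete (V : finType) (S : digraph V) : Prop :=
  forall x y : V, x != y -> S x y || S y x.

Definition strongly_connected (V : finType) (D : digraph V) : Prop :=
  forall x y : V, connect D x y.

(* [D] is obtained from the semicomplete digraph [S] by replacing every vertex
   [i] of [S] by the nonempty independent set [I_i = f^-1(i)], so that [f x]
   is the index of the partite set of [x]. *)
Definition extended_semicomplete (V : finType) (D : digraph V)
    (s : nat) (S : digraph 'I_s) (f : V -> 'I_s) : Prop :=
  [/\ semicomplete S,
      forall i : 'I_s, exists x : V, f x = i
    & forall x y : V, D x y = S (f x) (f y)].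

(* The partite sets are determined by [D] alone: an algorithm need not be
   given [f]. *)
Lemma same_partite_setE (V : finType) (D : digraph V)
    (s : nat) (S : digraph 'I_s) (f : V -> 'I_s) (x y : V) :
  extended_semicomplete D S f ->
  (f x == f y) = ~~ (D x y || D y x).
Proof.
case=> scS _ DE; rewrite !DE; have [-> | ne] := eqVneq; first by rewrite arc_irr.
by rewrite scS.
Qed.

(* A pair [(u, p)] stands for the nonempty vertex sequence [u :: p], which
   starts at [u], ends at [last u p] and has [size p] arcs. *)
Inductive gcycle (V : Type) :=
  | Cycle (c : seq V)
  | Paths (ps : seq (V * seq V)).

Definition gvertices (V : Type) (G : gcycle V) : seq V :=
  match G with
  | Cycle c => c
  | Paths ps => flatten [seq P.1 :: P.2 | P <- ps]
  end.

Definition garcs (V : Type) (G : gcycle V) : nat :=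
  match G with
  | Cycle c => size c
  | Paths ps => sumn [seq size P.2 | P <- ps]
  end.

(* [uniq (gvertices G)] says both that each path (or the cycle) does not repeat
   vertices and that distinct paths are disjoint.  A cycle has at least two
   vertices because [D] has no loops. *)
Definition is_gcycle (V : finType) (D : digraph V) (s : nat) (f : V -> 'I_s)
    (G : gcycle V) : Prop :=
  uniq (gvertices G) /\
  match G with
  | Cycle c => 0 < size c /\ cycle D c
  | Paths ps =>
      [/\ 0 < size ps,
          all (fun P => path D P.1 P.2) ps
        & cycle (fun P Q => f (last P.1 P.2) == f Q.1) ps]
  end.

Definition spanning_gcycle (V : finType) (D : digraph V) (s : nat)
    (f : V -> 'I_s) (G : gcycle V) : Prop :=
  is_gcycle D f G /\ forall x : V, x \in gvertices G.

Definition max_spanning_gcycle (V : finType) (D : digraph V) (s : nat)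
    (f : V -> 'I_s) (G : gcycle V) : Prop :=
  spanning_gcycle D f G /\
  forall G' : gcycle V, spanning_gcycle D f G' -> garcs G' <= garcs G.

Definition correct_answer (V : finType) (D : digraph V) (s : nat)
    (f : V -> 'I_s) (a : option (gcycle V)) : Prop :=
  match a with
  | Some G => max_spanning_gcycle D f G
  | None => ~ exists G : gcycle V, spanning_gcycle D f G
  end.

(* Model of computation: structured programs for a random access machine with
   registers and arrays of natural numbers (finitely many of each occur in a
   program).  The cost is uniform; as the only arithmetic is addition and
   truncated subtraction, the bit length of the numbers grows by at most one
   per operation, so this is polynomially equivalent to Turing machines
   (unit-cost multiplication would not be). *)
Inductive expr :=
  | Const (k : nat)
  | Reg (r : nat)
  | Get (a : nat) (e : expr)
  | Add (e1 e2 : expr)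
  | Sub (e1 e2 : expr).

Inductive test :=
  | Less (e1 e2 : expr)
  | Equal (e1 e2 : expr).

Inductive cmd :=
  | Skip
  | Assign (r : nat) (e : expr)
  | Put (a : nat) (e1 e2 : expr)
  | Seq (c1 c2 : cmd)
  | If (b : test) (c1 c2 : cmd)
  | While (b : test) (c : cmd).

Record state := State {
  reg : nat -> nat;
  arr : nat -> nat -> nat
}.

Fixpoint eval (st : state) (e : expr) : nat :=
  match e with
  | Const k => k
  | Reg r => reg st r
  | Get a e => arr st a (eval st e)
  | Add e1 e2 => eval st e1 + eval st e2
  | Sub e1 e2 => eval st e1 - eval st e2
  end.

Fixpoint expr_cost (e : expr) : nat :=
  match e with
  | Const _ | Reg _ => 1
  | Get _ e => (expr_cost e).+1
  | Add e1 e2 | Sub e1 e2 => (expr_cost e1 + expr_cost e2).+1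
  end.

Definition eval_test (st : state) (b : test) : bool :=
  match b with
  | Less e1 e2 => eval st e1 < eval st e2
  | Equal e1 e2 => eval st e1 == eval st e2
  end.

Definition test_cost (b : test) : nat :=
  match b with
  | Less e1 e2 | Equal e1 e2 => (expr_cost e1 + expr_cost e2).+1
  end.

Definition set_reg (st : state) (r v : nat) : state :=
  State (fun r' => if r' == r then v else reg st r') (arr st).

Definition set_arr (st : state) (a i v : nat) : state :=
  State (reg st)
    (fun a' i' => if (a' == a) && (i' == i) then v else arr st a' i').

(* [exec c st st' t]: started in [st], [c] halts in [st'] after [t] steps. *)
Inductive exec : cmd -> state -> state -> nat -> Prop :=
  | ExecSkip st : exec Skip st st 1
  | ExecAssign st r e :
      exec (Assign r e) st (set_reg st r (eval st e)) (expr_cost e).+1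
  | ExecPut st a e1 e2 :
      exec (Put a e1 e2) st (set_arr st a (eval st e1) (eval st e2))
        (expr_cost e1 + expr_cost e2).+1
  | ExecSeq c1 c2 st1 st2 st3 t1 t2 :
      exec c1 st1 st2 t1 -> exec c2 st2 st3 t2 ->
      exec (Seq c1 c2) st1 st3 (t1 + t2)
  | ExecIf b c1 c2 st st' t :
      exec (if eval_test st b then c1 else c2) st st' t ->
      exec (If b c1 c2) st st' (test_cost b + t)
  | ExecWhileFalse b c st :
      ~~ eval_test st b -> exec (While b c) st st (test_cost b)
  | ExecWhileTrue b c st1 st2 st3 t1 t2 :
      eval_test st1 b -> exec c st1 st2 t1 -> exec (While b c) st2 st3 t2 ->
      exec (While b c) st1 st3 (test_cost b + t1 + t2).

Lemma exec_deterministic c st st1 st2 t1 t2 :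
  exec c st st1 t1 -> exec c st st2 t2 -> st1 = st2 /\ t1 = t2.
Proof.
move=> E1; elim: E1 st2 t2 => {c st st1 t1}
  [st|st r e|st a e1 e2|c1 c2 sa sb sc ta tb _ IH1 _ IH2
  |b c1 c2 st st' t _ IH|b c st nb|b c sa sb sc ta tb hb _ IH1 _ IH2]
  st2 t2 E2; inversion E2; subst => //;
  repeat match goal with
  | IH : forall s t, exec ?c ?u s t -> _, E : exec ?c ?u _ _ |- _ =>
      case: (IH _ _ E) => ? ?; subst; clear IH
  end => //.
- by match goal with T : is_true (eval_test _ _) |- _ => rewrite T in nb end.
- by match goal with N : is_true (~~ _) |- _ => rewrite hb in N end.
Qed.

(* Input and output are lists stored in array 0, with their length in
   register 0; everything else is initially 0. *)
Definition initial (w : seq nat) : state :=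
  State (fun r => if r == 0 then size w else 0)
        (fun a i => if a == 0 then nth 0 w i else 0).

Definition output (st : state) : seq nat := mkseq (arr st 0) (reg st 0).

(* The number of vertices followed by the adjacency matrix, row by row. *)
Definition encode_digraph (n : nat) (D : digraph 'I_n) : seq nat :=
  n :: [seq nat_of_bool (D x y) | x <- enum 'I_n, y <- enum 'I_n].

(* Each path is preceded by its number of vertices, so that the encoding is
   injective. *)
Definition encode_answer (n : nat) (a : option (gcycle 'I_n)) : seq nat :=
  match a with
  | None => [:: 0]
  | Some (Cycle c) => 1 :: [seq val x | x <- c]
  | Some (Paths ps) =>
      2 :: flatten [seq (size P.2).+1 :: [seq val x | x <- P.1 :: P.2] | P <- ps]
  end.

(* Main.v *)
Require Import Defs.
From mathcomp Require Import all_boot all_fingroup zify path.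

Set Implicit Arguments.
Unset Strict Implicit.
Unset Printing Implicit Defensive.

(* Allow, besides the arcs of D, the pairs inside a partite set, at a price. A
   spanning G-cycle is then a permutation of the vertices with a single cycle,
   and it has as many arcs as there are unpaid steps, so that permutations of
   minimum price give an upper bound. Such a permutation is computed by the
   auction algorithm. It remains to merge its cycles without raising the price.
   Two cycles that meet a common partite set are merged by exchanging two
   successors. If no such exchange is possible between the cycle C of vertex 0
   and a cycle C' although there are arcs in both directions, then for x in C
   and y in C' the presence of the arc from N^i x to N^j y depends on i + j
   only, and this periodicity yields an exchange of four successors that merges
   C and C'. If every other cycle either is dominated by C or dominates C then
   strong connectivity gives an arc from a cycle of the first kind to a cycle
   of the second, and three cycles are merged at once. So a search among all
   exchanges of at most four successors, repeated n times, ends with a single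
   cycle. *)

(** * Orbits of a permutation after an exchange of successors *)

Section PermutationOrbits.
Variable V : finType.
Implicit Types N M : {perm V}.

(** A product of transpositions is a permutation even for repeated arguments: [p3 = p4] gives the
    exchanges of three successors, [p2 = p3 = p4] those of two. Each factor is one swap of two cells
    in the program. *)
Definition cyclic_shift N p1 p2 p3 p4 : {perm V} :=
  (tperm p3 p4 * (tperm p2 p3 * (tperm p1 p2 * N)))%g.

Lemma iter_in_porbit N x i : iter i N x \in porbit N x.
Proof. by rewrite -permX mem_porbit. Qed.

Lemma in_porbitP N x y :
  reflect (exists i, y = iter i N x) (y \in porbit N x).
Proof.
by apply: (iffP (porbitP N x y)) => -[i ->]; exists i; rewrite permX.
Qed.

Lemma porbit_trans N x y z :
  x \in porbit N y -> y \in porbit N z -> x \in porbit N z.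
Proof. by rewrite -!eq_porbit_mem => /eqP -> /eqP ->. Qed.

Lemma perm_in_porbit N x y : (N x \in porbit N y) = (x \in porbit N y).
Proof. by rewrite -!eq_porbit_mem; have := porbit_perm N 1 x; rewrite expg1 => ->. Qed.

(** Follow [N] from [x] to the first point of [P]: up to there [M] takes the same steps. *)
Lemma porbit_first_hit N M x (P : pred V) :
  (exists2 y, P y & y \in porbit N x) ->
  (forall z, z \in porbit N x -> ~~ P z -> M z = N z) ->
  exists p, [/\ P p, p \in porbit N x & p \in porbit M x].
Proof.
move=> [y Py /in_porbitP [k yk]] NM.
have ex : exists i, P (iter i N x) by exists k; rewrite -yk.
case: (ex_minnP ex) => i Pi min_i; exists (iter i N x); split=> //.
  exact: iter_in_porbit.
suff -> : iter i N x = iter i M x by apply: iter_in_porbit.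
have: forall j, j <= i -> iter j M x = iter j N x.
  elim=> // j IH ji; rewrite /= (IH (ltnW ji)) NM ?iter_in_porbit //.
  by apply/negP => /min_i; rewrite leqNgt ji.
by move/(_ i (leqnn i)).
Qed.

Lemma porbit_next_hit N M x y :
  y \in porbit N x -> y != x ->
  (forall z, z \in porbit N x -> z != x -> z != y -> M z = N z) ->
  y \in porbit M (N x).
Proof.
move=> /in_porbitP [k yk] yx NM.
have ex : exists i, iter i N x == y by exists k; rewrite -yk.
case: (ex_minnP ex) => -[|i] /eqP yi min_i; first by rewrite -yi eqxx in yx.
have: forall j, j <= i -> iter j M (N x) = iter j.+1 N x.
  elim=> // j IH ji; rewrite iterS (IH (ltnW ji)) NM // ?iter_in_porbit //.
    (* A return to [x] before [y] would let [y] be reached earlier than at the minimal time. *)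
    apply: contraTneq isT => loop.
    have: iter (i - j) N (iter j.+1 N x) == y.
      by rewrite -iterD addnS subnK ?yi // ltnW.
    by rewrite loop => /min_i; lia.
  by apply/negP => /min_i; rewrite leqNgt ltnS ji.
move/(_ i (leqnn i)); rewrite yi => <-; exact: iter_in_porbit.
Qed.

(** * Permutations that differ at marked points only *)

Section MarkedPoints.
Variables (N M : {perm V}) (ps : seq V).
Hypothesis NM : forall w, w \notin ps -> M w = N w.

(** From any point of the old orbit, [N] leads to a marked point along steps shared with [M]. So the
    old orbit lies in the [M]-orbit of the marked points, which also contains [y]. *)
Lemma porbit_grows x y z :
  (forall p, p \in ps -> p \in porbit M x) ->
  x \in ps -> x \in porbit N z -> y \in ps -> y \notin porbit N z ->
  #|porbit N z| < #|porbit M z|.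
Proof.
move=> psM xps xN yps yN.
have sub w : w \in porbit N z -> w \in porbit M x.
  move=> wN; have [||p [pps _ pM]] := @porbit_first_hit N M w [in ps].
  - by exists x => //; move: xN wN; rewrite porbit_sym -!eq_porbit_mem
      => /eqP <- /eqP ->.
  - by move=> v _; apply: NM.
  by apply: porbit_trans (psM p pps); rewrite porbit_sym.
have /eqP Mz : porbit M z == porbit M x.
  by rewrite eq_porbit_mem sub ?porbit_id.
rewrite Mz; apply/proper_card/properP; split; first by apply/subsetP.
by exists y; rewrite ?psM.
Qed.

(** The first marked point met from [N p] can only be [p], the sole one on its cycle. *)
Lemma porbit_next_unique p : p \in ps ->
  (forall q, q \in ps -> q \in porbit N p -> q = p) -> p \in porbit M (N p).
Proof.
move=> pps uniq_p; have [||q [qps]] := @porbit_first_hit N M (N p) [in ps].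
- by exists p; rewrite // porbit_sym perm_in_porbit porbit_id.
- by move=> v _; apply: NM.
move=> qN; suff -> : q = p by [].
apply: uniq_p => //; apply: porbit_trans qN _.
by rewrite perm_in_porbit porbit_id.
Qed.

End MarkedPoints.

Lemma cyclic_shift2 N p1 p2 : p1 != p2 ->
  [/\ cyclic_shift N p1 p2 p2 p2 p1 = N p2,
      cyclic_shift N p1 p2 p2 p2 p2 = N p1
    & forall w, w \notin [:: p1; p2] -> cyclic_shift N p1 p2 p2 p2 w = N w].
Proof.
move=> ne; rewrite /cyclic_shift !tperm1 !mul1g !permM tpermL tpermR.
split=> // w; rewrite !inE !negb_or permM => /andP [w1 w2].
by rewrite tpermD // eq_sym.
Qed.

Lemma cyclic_shift3 N p1 p2 p3 : uniq [:: p1; p2; p3] ->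
  [/\ cyclic_shift N p1 p2 p3 p3 p1 = N p2,
      cyclic_shift N p1 p2 p3 p3 p2 = N p3,
      cyclic_shift N p1 p2 p3 p3 p3 = N p1
    & forall w, w \notin [:: p1; p2; p3] -> cyclic_shift N p1 p2 p3 p3 w = N w].
Proof.
rewrite /= !inE negb_or andbT => /andP [/andP [n12 n13] n23].
rewrite /cyclic_shift tperm1 mul1g; split=> [||| w]; rewrite !permM !permE /=.
- by rewrite !(negbTE n12) (negbTE n13) eqxx.
- by rewrite eqxx !(eq_sym p3) (negbTE n13) (negbTE n23).
- by rewrite eqxx (eq_sym p3) (negbTE n23) (eq_sym p2) (negbTE n12) eqxx.
rewrite !inE !negb_or => /and3P [/negbTE w1 /negbTE w2 /negbTE w3].
by rewrite w2 w3 w1 w2.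
Qed.

Lemma cyclic_shift4 N p1 p2 p3 p4 : uniq [:: p1; p2; p3; p4] ->
  let M := cyclic_shift N p1 p2 p3 p4 in
  [/\ M p1 = N p2, M p2 = N p3, M p3 = N p4, M p4 = N p1
    & forall w, w \notin [:: p1; p2; p3; p4] -> M w = N w].
Proof.
rewrite /= !inE !negb_or andbT => /and3P [/and3P [n12 n13 n14]].
case/andP=> n23 n24 n34 /=; have neqs := (negbTE n12, negbTE n13, negbTE n14,
  negbTE n23, negbTE n24, negbTE n34).
have neqs' := (eq_sym p2 p1, eq_sym p3 p1, eq_sym p4 p1, eq_sym p3 p2,
  eq_sym p4 p2, eq_sym p4 p3).
rewrite /cyclic_shift; split=> [|||| w]; rewrite !permM !permE /=;
  do ?by repeat rewrite ?(neqs', neqs) ?eqxx /=.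
rewrite !inE !negb_or => /and4P [/negbTE w1 /negbTE w2 /negbTE w3 /negbTE w4].
by repeat rewrite ?(w1, w2, w3, w4) /=.
Qed.

End PermutationOrbits.

(** * Merging cycles *)

Section Cost.
Variables (V : finType) (D : digraph V).

(* The values [0], [q], [q ^ 2] stand for an arc, a pair inside a partite set
   and a forbidden pair: all [#|V| < q] pairs inside partite sets together are
   cheaper than a single forbidden pair. *)
Definition cost (x y : V) : nat :=
  let q := #|V|.+1 in if D x y then 0 else if D y x then q ^ 2 else q.

Definition perm_cost (N : {perm V}) : nat := \sum_x cost x (N x).

Definition grows (z : V) (N M : {perm V}) : bool :=
  (perm_cost M <= perm_cost N) && (#|porbit N z| < #|porbit M z|).

Lemma cost_arc x y : D x y -> cost x y = 0.
Proof. by rewrite /cost => ->. Qed.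

End Cost.

(** * Exchanges of successors that merge cycles *)

Section Merging.
Variables (V : finType) (D : digraph V) (s : nat) (S : digraph 'I_s).
Variable f : V -> 'I_s.
Hypothesis extD : extended_semicomplete D S f.
Implicit Types N M : {perm V}.

Lemma arcE x y : D x y = S (f x) (f y).
Proof. by case: extD. Qed.

Lemma arc_or x y : f x != f y -> D x y || D y x.
Proof. by case: extD => sc _ _ /sc; rewrite -!arcE. Qed.

Lemma cost_similar x x' y : f x = f x' -> cost D x y = cost D x' y.
Proof. by move=> xx'; rewrite /cost !arcE xx'. Qed.

Lemma cost_inside x y : f x = f y -> cost D x y = #|V|.+1.
Proof. by move=> xy; rewrite /cost !arcE xy arc_irr. Qed.

Lemma perm_cost_arcs N M (ps : seq V) :
  (forall w, w \notin ps -> M w = N w) ->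
  (forall p, p \in ps -> D p (M p)) ->
  perm_cost D M <= perm_cost D N.
Proof.
move=> NM DM; apply: leq_sum => w _.
by have [/DM /cost_arc -> // | /NM ->] := boolP (w \in ps).
Qed.

Lemma porbit_neq N x y z : x \in porbit N z -> y \notin porbit N z -> x != y.
Proof. by move=> xz; apply: contraNneq => <-. Qed.

Lemma porbit_eq N x z : x \in porbit N z -> porbit N x = porbit N z.
Proof. by rewrite -eq_porbit_mem => /eqP. Qed.

Lemma merge2_orbit N x y z : x \in porbit N z -> y \notin porbit N z ->
  #|porbit N z| < #|porbit (cyclic_shift N x y y y) z|.
Proof.
move=> xz yz; have xy := porbit_neq xz yz.
have [Mx My NM] := cyclic_shift2 N xy; set M := cyclic_shift _ _ _ _ _ in Mx My NM *.
apply: (porbit_grows NM (x := x) (y := y)); rewrite ?inE ?eqxx ?orbT //.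
move=> p; rewrite !inE => /orP [] /eqP ->; first exact: porbit_id.
have: y \in porbit M (N y).
  apply: (porbit_next_unique NM); first by rewrite !inE eqxx orbT.
  move=> q; rewrite !inE => /orP [] /eqP -> //.
  by rewrite porbit_sym (porbit_eq xz) (negbTE yz).
by rewrite -Mx => /porbit_trans; apply; rewrite perm_in_porbit porbit_id.
Qed.

(** Vertices of one partite set have equal costs towards every vertex, so swapping their successors
    only permutes the terms of the total cost. *)
Lemma exchange_similar N x y z :
  x \in porbit N z -> y \notin porbit N z -> f x = f y ->
  grows D z N (cyclic_shift N x y y y).
Proof.
move=> xz yz fxy; rewrite /grows merge2_orbit // andbT.
have [Mx My NM] := cyclic_shift2 N (porbit_neq xz yz).
rewrite /perm_cost [leqRHS](reindex_inj (@perm_inj _ (tperm x y))) /=.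
apply: leq_sum => w _; case: tpermP => [->|->|/eqP wx /eqP wy].
- by rewrite Mx (cost_similar _ fxy).
- by rewrite My (cost_similar _ fxy).
- by rewrite NM // !inE (negbTE wx) (negbTE wy).
Qed.

Lemma exchange2 N x y z :
  x \in porbit N z -> y \notin porbit N z -> D x (N y) -> D y (N x) ->
  grows D z N (cyclic_shift N x y y y).
Proof.
move=> xz yz Dxy Dyx; rewrite /grows merge2_orbit // andbT.
have [Mx My NM] := cyclic_shift2 N (porbit_neq xz yz).
by apply: perm_cost_arcs NM _ => p; rewrite !inE => /orP [] /eqP ->;
  rewrite ?Mx ?My.
Qed.

(** Three cycles are opened after [p1], [p2] and [p3] and joined in a ring. *)
Lemma exchange3 N p1 p2 p3 z :
  p1 \in porbit N z -> p2 \notin porbit N z -> p3 \notin porbit N z ->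
  p3 \notin porbit N p2 ->
  D p1 (N p2) -> D p2 (N p3) -> D p3 (N p1) ->
  grows D z N (cyclic_shift N p1 p2 p3 p3).
Proof.
move=> p1z p2z p3z p32 D12 D23 D31.
have n23 : p2 != p3 by apply: contraNneq p32 => ->; apply: porbit_id.
have uniq_p : uniq [:: p1; p2; p3].
  by rewrite /= !inE negb_or (porbit_neq p1z p2z) (porbit_neq p1z p3z) n23.
have [M1 M2 M3 NM] := cyclic_shift3 N uniq_p.
set M := cyclic_shift _ _ _ _ _ in M1 M2 M3 NM *.
apply/andP; split.
  by apply: perm_cost_arcs NM _ => p; rewrite !inE => /or3P [] /eqP ->;
    rewrite ?M1 ?M2 ?M3.
have h2 : p2 \in porbit M (N p2).
  apply: (porbit_next_unique NM); first by rewrite !inE eqxx orbT.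
  move=> q; rewrite !inE => /or3P [] /eqP -> //.
    by rewrite porbit_sym (porbit_eq p1z) (negbTE p2z).
  by rewrite (negbTE p32).
have h3 : p3 \in porbit M (N p3).
  apply: (porbit_next_unique NM); first by rewrite !inE eqxx !orbT.
  move=> q; rewrite !inE => /or3P [] /eqP -> //.
    by rewrite porbit_sym (porbit_eq p1z) (negbTE p3z).
  by rewrite porbit_sym (negbTE p32).
rewrite -M1 in h2; rewrite -M2 in h3.
have h21 : p2 \in porbit M p1.
  by apply: porbit_trans h2 _; rewrite perm_in_porbit porbit_id.
apply: (porbit_grows NM (x := p1) (y := p2)); rewrite ?inE ?eqxx ?orbT //.
move=> p; rewrite !inE => /or3P [] /eqP -> //; first exact: porbit_id.
by apply: porbit_trans h3 _; rewrite perm_in_porbit.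
Qed.

(** Each of the two cycles is cut into two segments. The new cycle runs through the four segments in
    the order of their ends [p4], [p3], [p2], [p1]. *)
Lemma exchange4 N p1 p2 p3 p4 z :
  p1 \in porbit N z -> p3 \in porbit N z -> p2 \notin porbit N z ->
  p4 \in porbit N p2 -> p1 != p3 -> p2 != p4 ->
  D p1 (N p2) -> D p2 (N p3) -> D p3 (N p4) -> D p4 (N p1) ->
  grows D z N (cyclic_shift N p1 p2 p3 p4).
Proof.
move=> p1z p3z p2z p42 n13 n24 D12 D23 D34 D41.
have p4z : p4 \notin porbit N z.
  by apply: contra p2z => p4z; rewrite porbit_sym in p42; apply: porbit_trans p42 _.
have uniq_p : uniq [:: p1; p2; p3; p4].
  rewrite /= !inE !negb_or n13 n24 (porbit_neq p1z p2z) (porbit_neq p1z p4z).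
  by rewrite (porbit_neq p3z p4z) eq_sym (porbit_neq p3z p2z).
have [M1 M2 M3 M4 NM] := cyclic_shift4 N uniq_p.
set M := cyclic_shift _ _ _ _ _ in M1 M2 M3 M4 NM *.
apply/andP; split.
  by apply: perm_cost_arcs NM _ => p; rewrite !inE => /or4P [] /eqP ->;
    rewrite ?M1 ?M2 ?M3 ?M4.
have inside w v : w \in porbit N z -> v \in porbit N w -> v != p1 -> v != p3 ->
    M v = N v.
  move=> wz vw v1 v3; apply: NM; rewrite !inE (negbTE v1) (negbTE v3) /=.
  rewrite (porbit_eq wz) in vw.
  by rewrite (negbTE (porbit_neq vw p2z)) (negbTE (porbit_neq vw p4z)).
have outside w v : w \in porbit N p2 -> v \in porbit N w -> v != p2 -> v != p4 ->
    M v = N v.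
  move=> w2 vw v2 v4; apply: NM; rewrite !inE (negbTE v2) (negbTE v4) /= orbF.
  have vz : v \notin porbit N z.
    apply: contra p2z => vz; rewrite (porbit_eq w2) porbit_sym in vw.
    exact: porbit_trans vw vz.
  by rewrite !(eq_sym v) (negbTE (porbit_neq p1z vz)) (negbTE (porbit_neq p3z vz)).
have h2 : p4 \in porbit M (N p2).
  by apply: porbit_next_hit => //; [rewrite eq_sym | move=> v; apply: outside;
    rewrite porbit_id].
have h4 : p2 \in porbit M (N p4).
  apply: porbit_next_hit; rewrite ?(porbit_eq p42) ?porbit_id //.
  by move=> v vp v4 v2; apply: (outside p2); rewrite ?porbit_id.
have h1 : p3 \in porbit M (N p1).
  apply: porbit_next_hit; rewrite ?(porbit_eq p1z) // 1?eq_sym //.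
  by move=> v vp v1 v3; apply: (inside p1); rewrite ?(porbit_eq p1z).
have h3 : p1 \in porbit M (N p3).
  apply: porbit_next_hit; rewrite ?(porbit_eq p3z) //.
  by move=> v vp v3 v1; apply: (inside p3); rewrite ?(porbit_eq p3z).
rewrite -M1 in h2; rewrite -M4 in h1; rewrite -M3 in h4.
have step p q : q \in porbit M (M p) -> p \in porbit M p1 -> q \in porbit M p1.
  by move=> qp pp1; apply: porbit_trans qp _; rewrite perm_in_porbit.
have c4 := step _ _ h2 (porbit_id M p1).
have c3 := step _ _ h1 c4; have c2 := step _ _ h4 c3.
apply: (porbit_grows NM (x := p1) (y := p2)); rewrite ?inE ?eqxx ?orbT //.
by move=> p; rewrite !inE => /or4P [] /eqP -> //; apply: porbit_id.
Qed.

Lemma iter_perm_order N x : iter #[N]%g N x = x.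
Proof. by rewrite -permX expg_order perm1. Qed.

(** * Arcs between the cycle of [z] and the others when no exchange is possible *)

Section NoExchange.
Variables (N : {perm V}) (z : V).
Hypothesis stuck : forall p1 p2 p3 p4,
  ~~ grows D z N (cyclic_shift N p1 p2 p3 p4).

Lemma stuck_arc_or x y :
  x \in porbit N z -> y \notin porbit N z -> D x y || D y x.
Proof.
move=> xz yz; apply: arc_or; apply: contraNneq (stuck x y y y) => fxy.
exact: exchange_similar.
Qed.

Lemma iter_inside x i : x \in porbit N z -> iter i N x \in porbit N z.
Proof. exact: porbit_trans (iter_in_porbit _ _ _). Qed.

Lemma iter_outside y i : y \notin porbit N z -> iter i N y \notin porbit N z.
Proof.
apply: contra => iz; apply: porbit_trans iz.
by rewrite porbit_sym iter_in_porbit.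
Qed.

(** The alternative is an arc from [y] to [N x], which together with the given arc would allow
    [exchange2]. *)
Lemma stuck_shift x y : x \in porbit N z -> y \notin porbit N z ->
  D x (N y) -> D (N x) y.
Proof.
move=> xz yz Dxy; have /orP [//|Dyx] := stuck_arc_or (iter_inside 1 xz) yz.
by case/negP: (stuck x y y y); apply: exchange2.
Qed.

Lemma stuck_shift_iter i x y : x \in porbit N z -> y \notin porbit N z ->
  D x (iter i N y) -> D (iter i N x) y.
Proof.
elim: i x => // i IH x xz yz /= /(stuck_shift xz (iter_outside i yz)) Dxy.
by rewrite -iterS iterSr IH //; apply: (iter_inside 1).
Qed.

(** One step back is as many steps forward as the order of [N] minus one. *)
Lemma stuck_unshift x y : x \in porbit N z -> y \notin porbit N z ->
  D (N x) y -> D x (N y).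
Proof.
move=> xz yz; rewrite -{1}(iter_perm_order N y) -(prednK (order_gt0 N)) iterSr.
move/(stuck_shift_iter (iter_inside 1 xz) (iter_outside 1 yz)).
by rewrite /= -iterSr prednK ?order_gt0 // iter_perm_order.
Qed.

Lemma stuck_iterE i x y : x \in porbit N z -> y \notin porbit N z ->
  D (iter i N x) y = D x (iter i N y).
Proof.
move=> xz yz; apply/idP/idP; last exact: stuck_shift_iter.
elim: i y yz => // i IH y yz /= /(stuck_unshift (iter_inside i xz) yz) /IH.
by rewrite -iterS iterSr; apply; apply: (iter_outside 1).
Qed.

(** With arcs both ways, the predecessor of [x] dominates [N y] by [stuck_unshift], so it could
    exchange successors with [y]. *)
Lemma stuck_asym x y : x \in porbit N z -> y \notin porbit N z ->
  D y x -> ~~ D x y.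
Proof.
move=> xz yz Dyx; apply/negP => Dxy.
have xE := iter_perm_order N x; rewrite -(prednK (order_gt0 N)) /= in xE.
set x' := iter _ N x in xE; have x'z : x' \in porbit N z by apply: iter_inside.
rewrite -xE in Dyx Dxy; case/negP: (stuck x' y y y).
by apply: exchange2 => //; apply: stuck_unshift.
Qed.

(* [G m] tells whether [iter i N x] dominates [iter j N y] when [i + j = m].
   If no exchange of four arcs is possible then the complement of [G] is
   stable under adding the difference [t] of a point outside and a point
   inside [G], which is absurd as [G] is periodic. *)
Lemma stuck_one_way x y x' y' : x \in porbit N z -> y \notin porbit N z ->
  x' \in porbit N z -> y' \in porbit N y -> D x y -> ~~ D y' x'.
Proof.
move=> xz yz x'z y'y Dxy; apply/negP => Dyx.
have y'z : y' \notin porbit N z.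
  by case/in_porbitP: y'y => i ->; apply: iter_outside.
pose G m := D x (iter m N y).
have GE i j : D (iter i N x) (iter j N y) = G (i + j).
  by rewrite stuck_iterE ?iter_outside // -iterD.
have notG i j : ~~ G (i + j) -> D (iter j N y) (iter i N x).
  rewrite -GE => nD.
  have := stuck_arc_or (iter_inside i xz) (iter_outside j yz).
  by rewrite (negbTE nD).
set P := #[N]%g; have P_gt0 : 0 < P := order_gt0 N.
have GP k m : G (m + k * P) = G m.
  elim: k => [|k IH]; first by rewrite addn0.
  by rewrite mulSnr addnA -IH /G iterD iter_perm_order.
(* Otherwise [exchange4] applies to [x], [N^u y], [N^t x], [N^w y]; the values of [G] also separate
   the two points on each cycle. *)
have no4 u t w : G u.+1 -> ~~ G (u.+1 + t) -> ~~ G w.+1 -> ~~ G (w.+1 + t).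
  move=> Gu Gut Gw; apply/negP => Gwt.
  case/negP: (stuck x (iter u N y) (iter t N x) (iter w N y)).
  have wP i : y \in porbit N (iter i N y).
    by rewrite porbit_sym iter_in_porbit.
  apply: exchange4; rewrite ?(iter_inside t xz) //.
  - exact: iter_outside.
  - exact: porbit_trans (iter_in_porbit _ _ _) (wP u).
  - by apply: contraNneq Gut => xt; rewrite addnC -GE -xt.
  - by apply: contraNneq Gw => yuw; rewrite /G /= -yuw.
  - by rewrite -iterS; apply: notG; rewrite addSn addnC.
  - by rewrite -iterS GE addnC.
  - by apply: (notG 1).
have [a x'E] : exists a, x' = iter a N x.
  by apply/in_porbitP; rewrite (porbit_eq xz).
have [b y'E] : exists b, y' = iter b N y by apply/in_porbitP.
have Gab : ~~ G (a + b) by rewrite -GE -x'E -y'E; apply: stuck_asym.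
have GPP : G P by have := GP 1 0; rewrite add0n mul1n => ->.
(* Modulo the period [P] this is the difference of [a + b], outside [G], and [P], inside [G]. *)
pose t := a + b + P.
have Gt k : ~~ G (P + t * k.+1).
  elim: k => [|k IH]; last first.
    have := no4 P.-1 t (P + t * k.+1).-1.
    rewrite !prednK ?addn_gt0 ?P_gt0 // -addnA -mulnSr; apply=> //.
    by have -> : P + t = a + b + 2 * P; rewrite ?GP // /t; lia.
  by have -> : P + t * 1 = a + b + 2 * P; rewrite ?GP // /t; lia.
(* [P + t * P] is a multiple of the period, hence in [G] like [P]. *)
by have := Gt P.-1; rewrite prednK // GP GPP.
Qed.

End NoExchange.

(** Suppose that no exchange works, and let [O] collect the cycles that receive an arc from the
    cycle of [z]. An arc leaving [O] ends on a cycle from which all arcs go to the cycle of [z], so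
    that the three cycles admit [exchange3]. *)
Lemma exists_growing_shift N z : strongly_connected D ->
  (exists y, y \notin porbit N z) ->
  exists p1 p2 p3 p4, grows D z N (cyclic_shift N p1 p2 p3 p4).
Proof.
move=> strD [y yz].
have [|] := boolP [exists p1, exists p2, exists p3, exists p4,
    grows D z N (cyclic_shift N p1 p2 p3 p4)].
  by case/existsP=> p1 /existsP [p2] /existsP [p3] /existsP [p4] g;
    exists p1, p2, p3, p4.
move/existsPn => no; have {no} stuck p1 p2 p3 p4 :
    ~~ grows D z N (cyclic_shift N p1 p2 p3 p4).
  have := no p1; move/existsPn/(_ p2)/existsPn/(_ p3)/existsPn/(_ p4).
  by [].
exfalso.
have leave (A : pred V) u v : A u -> ~~ A v -> exists u' v', [/\ A u', ~~ A v' & D u' v'].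
  move=> Au Av; have /connectP [p] := strD u v.
  elim: p u Au => [|w p IH] u Au /=; first by move=> _ vu; rewrite vu Au in Av.
  case/andP=> Duw pw vE; have [Aw | Aw] := boolP (A w); first exact: IH pw vE.
  by exists u, w.
pose O := [pred w | (w \notin porbit N z) &&
  [exists u in porbit N z, exists v in porbit N w, D u v]].
have [u [v [uz vz Duv]]] := leave [in porbit N z] z y (porbit_id N z) yz.
have Ov : O v.
  rewrite /= vz; apply/existsP; exists u; rewrite uz.
  by apply/existsP; exists v; rewrite porbit_id.
have [|v1 [w1 [Ov1 Ow1 Dvw]]] := leave O v z Ov.
  by rewrite /= porbit_id.
have domO w : O w -> forall x, x \in porbit N z -> ~~ D w x.
  case/andP=> wz /existsP [x0 /andP [x0z /existsP [w0 /andP [w0w D0]]]] x xz.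
  apply: stuck_one_way D0 => //; last by rewrite porbit_sym.
  by apply: contra wz; apply: porbit_trans; rewrite porbit_sym.
have w1z : w1 \notin porbit N z by apply: contraTN Dvw => /domO ->.
have v1z : v1 \notin porbit N z by case/andP: Ov1.
have OE w w' : w' \in porbit N w -> O w' = O w.
  move=> ww'; have e := porbit_eq ww'.
  by rewrite /= e -(eq_porbit_mem N w') -(eq_porbit_mem N w) e.
(* The arc from [v1] has to end at a successor, so the third cycle is opened after the predecessor
   [w] of [w1]. *)
set w := (N^-1)%g w1; have Nw : N w = w1 by rewrite /w permKV.
have ww1 : w \in porbit N w1 by rewrite -Nw porbit_sym perm_in_porbit porbit_id.
have zz := porbit_id N z.
case/negP: (stuck z v1 w w); apply: exchange3 => //.
- by apply: contra w1z => /porbit_eq e; rewrite -e porbit_sym.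
- apply: contra Ow1 => wv1; rewrite -(OE _ _ ww1) (OE _ _ wv1) //.
- have Nv1 : N v1 \notin porbit N z by rewrite perm_in_porbit.
  have /orP [//|D1] := stuck_arc_or stuck zz Nv1.
  have ONv1 : O (N v1) by rewrite (OE v1) // perm_in_porbit porbit_id.
  by have := domO _ ONv1 z zz; rewrite D1.
- by rewrite Nw.
- have wz : w \notin porbit N z by rewrite -perm_in_porbit Nw.
  have Nz : N z \in porbit N z by rewrite perm_in_porbit.
  have /orP [D1|//] := stuck_arc_or stuck Nz wz.
  case/negP: Ow1; rewrite -(OE _ _ ww1) /= wz; apply/existsP; exists (N z).
  by rewrite Nz; apply/existsP; exists w; rewrite porbit_id.
Qed.

End Merging.

(** * Optimal permutations and the auction *)

Section Auction.
Variables (V : finType) (D : digraph V).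
Implicit Types (mu om : V -> option V) (p : V -> nat).

(* [mu] maps bidders to items and [om] maps items to their owners; the last
   condition is complementary slackness up to one unit. *)
Definition auction_inv mu om p :=
  [/\ forall x y, mu x = Some y <-> om y = Some x,
      forall y, om y = None -> p y = 0,
      forall y, p y <= (#|V|.+1 ^ 2).+1
    & forall x y, mu x = Some y ->
        forall y', cost D x y + p y <= (cost D x y' + p y').+1].

Definition bid_mu mu om x y : V -> option V := fun z =>
  if z == x then Some y else if om y == Some z then None else mu z.
Definition bid_om om x y : V -> option V := fun z =>
  if z == y then Some x else om z.
Definition bid_price p y : V -> nat := fun z => if z == y then (p z).+1 else p z.

Lemma cost_le x y : cost D x y <= #|V|.+1 ^ 2.
Proof.
rewrite /cost; case: ifP => // _; case: ifP => // _.
by rewrite -mulnn leq_pmulr.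
Qed.

Lemma sum_bid_price p y : \sum_z bid_price p y z = (\sum_z p z).+1.
Proof.
rewrite (bigD1 y) //= [in RHS](bigD1 y) //= /bid_price eqxx addSn.
by congr (_ + _).+1; apply: eq_bigr => z /negbTE ->.
Qed.

(** A free bidder leaves a free item, of price 0, so the price of the best item is at most one
    forbidden pair and may still rise by one. This rise is what the unit of slack absorbs. *)
Lemma auction_inv_bid mu om p x y : auction_inv mu om p -> mu x = None ->
  (forall y', cost D x y + p y <= cost D x y' + p y') ->
  auction_inv (bid_mu mu om x y) (bid_om om x y) (bid_price p y).
Proof.
move=> [muom p0 p_le slack] mux best.
(* If all items were owned, [om] would be injective, hence onto, and [x] would own an item. *)
have [w omw] : exists w, om w = None.
  case: (pickP (fun w => om w == None)) => [w /eqP|all_owned]; first by exists w.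
  have own_inj : injective (fun w => odflt x (om w)).
    move=> w w'; have := all_owned w; have := all_owned w'.
    case w'E: (om w') => [v'|] //; case wE: (om w) => [v|] // _ _ /= vv'.
    rewrite vv' in wE; move/muom: wE; move/muom: w'E => -> [].
    by [].
  have [g _ gK] := injF_bij own_inj; have := gK x.
  case wE: (om (g x)) (all_owned (g x)) => [v|] // _ /= vx.
  by rewrite vx in wE; move/muom: wE; rewrite mux.
have price_y : p y <= #|V|.+1 ^ 2.
  have := best w; rewrite (p0 _ omw) addn0 => le_w.
  by apply: leq_trans (leq_trans le_w (cost_le x w)); apply: leq_addl.
split.
- move=> a b; rewrite /bid_mu /bid_om.
  have [-> | ax] := eqVneq a x; have [-> | b_y] := eqVneq b y.
  + by split.
  + split=> [[yb]|/muom]; last by rewrite mux.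
    by rewrite yb eqxx in b_y.
  + case: eqVneq => [omy|omy]; first by split=> // -[xa]; rewrite xa eqxx in ax.
    split=> [/muom omy'|[xa]]; last by rewrite xa eqxx in ax.
    by rewrite omy' eqxx in omy.
  + case: eqVneq => [omy|_]; last exact: muom.
    split=> // /muom mua; move/muom: omy; rewrite mua => -[yb].
    by rewrite yb eqxx in b_y.
- by move=> z; rewrite /bid_om /bid_price; case: eqP => // _; apply: p0.
- by move=> z; rewrite /bid_price; case: eqP => [->|_].
- move=> a b; rewrite /bid_mu /bid_price.
  have [-> [<-] b' | ax] := eqVneq a x.
    rewrite eqxx addnS ltnS; apply: leq_trans (best b') _.
    by rewrite leq_add2l; case: eqP.
  case: eqVneq => // omy mua b'.
  have -> : (b == y) = false.
    by apply: contraNF omy => /eqP <-; apply/eqP/muom.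
  apply: leq_trans (slack _ _ mua b') _.
  by rewrite ltnS leq_add2l; case: eqP.
Qed.

(** Each bid raises this sum by one, so the bound limits the number of bids. *)
Lemma auction_sum_price mu om p : auction_inv mu om p ->
  \sum_z p z < #|V|.+1 ^ 3 .
Proof.
case=> _ _ p_le _; have : \sum_z p z <= \sum_(z : V) (#|V|.+1 ^ 2).+1.
  by apply: leq_sum => z _.
rewrite sum_nat_const !expnS expn0 => le; apply: leq_ltn_trans le _.
by rewrite (_ : #|xpredT| = #|V|) //; move: #|V| => v; nia.
Qed.

Lemma perm_cost_dvd (N : {perm V}) : #|V|.+1 %| perm_cost D N.
Proof.
apply: dvdn_sum => x _; rewrite /cost.
by case: ifP => // _; case: ifP => // _; rewrite dvdn_exp.
Qed.

(** When slackness is summed over all bidders the prices cancel and an error of at most [#|V|]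
    remains. It vanishes because costs of permutations are multiples of [#|V|.+1]. *)
Lemma auction_optimal mu om p (N : {perm V}) : auction_inv mu om p ->
  (forall x, mu x = Some (N x)) -> forall M, perm_cost D N <= perm_cost D M.
Proof.
move=> [_ _ _ slack] muN M.
have: \sum_x (cost D x (N x) + p (N x)) <= \sum_x (cost D x (M x) + p (M x)).+1.
  by apply: leq_sum => x _; apply: slack.
under [leqRHS]eq_bigr do rewrite -addn1.
rewrite !big_split /= sum1_card -!/(perm_cost _ _).
have sum_p (L : {perm V}) : \sum_x p (L x) = \sum_x p x.
  by rewrite [RHS](reindex_inj (@perm_inj _ L)).
rewrite !sum_p.
have /dvdnP [a ->] := perm_cost_dvd N; have /dvdnP [b ->] := perm_cost_dvd M.
move=> le_ab; rewrite leq_mul2r /=; suff: a < b.+1 by [].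
rewrite -(ltn_pmul2r (ltn0Sn #|V|)) mulSn.
by rewrite (_ : #|xpredT| = #|V|) // in le_ab; lia.
Qed.

Lemma auction_perm mu om p : auction_inv mu om p ->
  (forall x, mu x != None) -> exists N : {perm V}, forall x, mu x = Some (N x).
Proof.
move=> [muom _ _ _] total.
have mu_inj : injective (fun x => odflt x (mu x)).
  move=> x x'; have := total x; have := total x'.
  case x'E: (mu x') => [v'|] //; case xE: (mu x) => [v|] // _ _ /= vv'.
  by rewrite vv' in xE; move/muom: xE; move/muom: x'E => -> [].
exists (perm mu_inj) => x; rewrite permE.
by case: (mu x) (total x).
Qed.

End Auction.

(** * Spanning G-cycles and permutations of minimum cost *)

Section OptimalPermutations.
Variables (V : finType) (D : digraph V) (s : nat) (S : digraph 'I_s).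
Variable f : V -> 'I_s.
Hypothesis extD : extended_semicomplete D S f.
Implicit Types N M : {perm V}.

Section Optimal.
Variable N : {perm V}.
Hypothesis optN : forall M, perm_cost D N <= perm_cost D M.

(** The identity uses only pairs inside partite sets and costs less than a single forbidden pair. *)
Lemma optimal_cost x : cost D x (N x) = #|V|.+1 * ~~ D x (N x).
Proof.
have: perm_cost D N < #|V|.+1 ^ 2.
  apply: leq_ltn_trans (optN 1%g) _; rewrite /perm_cost.
  under eq_bigr do rewrite perm1 (cost_inside extD) //.
  by rewrite sum_nat_const -mulnn ltn_pmul2r.
rewrite /perm_cost (bigD1 x) //= => /(leq_ltn_trans (leq_addr _ _)); rewrite /cost.
case: (D x (N x)); first by rewrite muln0.
by case: (D (N x) x); rewrite ?muln1 ?ltnn.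
Qed.

Lemma optimal_similar x : ~~ D x (N x) -> f x = f (N x).
Proof.
move=> nD; have := optimal_cost x; rewrite nD muln1 /cost (negbTE nD).
case: ifP => [_ /eqP|/negbT nD' _]; last first.
  by apply/eqP; rewrite (same_partite_setE _ _ extD) negb_or nD.
by rewrite -{2}[_.+1]expn1 eqn_exp2l // ltnS; apply/card_gt0P; exists x.
Qed.

Lemma optimal_perm_cost : perm_cost D N = #|V|.+1 * \sum_x ~~ D x (N x).
Proof. by rewrite big_distrr; apply: eq_bigr => x _; apply: optimal_cost. Qed.

End Optimal.

Lemma cycle_flatten (e : rel V) (ps : seq (V * seq V)) :
  cycle e (flatten [seq P.1 :: P.2 | P <- ps]) =
  all (fun P => path e P.1 P.2) ps && cycle (fun P Q => e (last P.1 P.2) Q.1) ps.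
Proof.
case: ps => [|[u p] ps] //=; rewrite rcons_cat cat_path -andbA; congr (_ && _).
(* Generalised to the stretch from the end of [P] to the start of [Q]; for the whole cycle both are
   the first path. *)
have aux Q : forall ps P,
    path e (last P.1 P.2) (rcons (flatten [seq P.1 :: P.2 | P <- ps]) Q.1) =
    all (fun P => path e P.1 P.2) ps &&
    path (fun P Q => e (last P.1 P.2) Q.1) P (rcons ps Q).
  elim=> [|[w l] ps' IH] P //=.
  by rewrite rcons_cat cat_path (IH (w, l)) /= -!andbA; do !bool_congr.
exact: (aux (u, p) ps (u, p)).
Qed.

Lemma size_flatten_paths (ps : seq (V * seq V)) :
  size (flatten [seq P.1 :: P.2 | P <- ps]) =
  sumn [seq size P.2 | P <- ps] + size ps.
Proof.
by elim: ps => //= P ps IH; rewrite size_cat IH; lia.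
Qed.

Lemma cycle_perm (e : rel V) (c : seq V) : uniq c -> (forall x, x \in c) ->
  cycle e c -> exists M : {perm V}, forall x, e x (M x).
Proof.
move=> Uc all_c ec; exists (perm (can_inj (prev_next Uc))) => x.
by rewrite permE next_cycle.
Qed.

(** Follow the G-cycle and step from the end of each path to the start of the next. Only these steps
    can be paid, and there are as many paths as vertices minus arcs. *)
Lemma spanning_gcycle_perm G : spanning_gcycle D f G ->
  garcs G <= #|V| /\
  exists M, perm_cost D M <= #|V|.+1 * (#|V| - garcs G).
Proof.
case: G => [c|ps] [[/= Uc HG] all_c].
  case: HG => _ HG; split; first by rewrite -(card_uniqP Uc) max_card.
  have [M DM] := cycle_perm Uc all_c HG; exists M.
  by rewrite /perm_cost big1 // => x _; rewrite cost_arc.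
case: HG => _ HG links.
have size_ps : #|V| = sumn [seq size P.2 | P <- ps] + size ps.
  rewrite -size_flatten_paths -(card_uniqP Uc); apply: eq_card => x.
  by rewrite all_c.
split; first by rewrite size_ps leq_addr.
set lasts := [seq last P.1 P.2 | P <- ps].
pose e x y := D x y || (x \in lasts) && (f x == f y).
have [|M eM] := @cycle_perm e _ Uc all_c.
  rewrite cycle_flatten; apply/andP; split.
    by apply: sub_all HG => P; apply: sub_path => x y; rewrite /e => ->.
  apply: (sub_in_cycle (P := [in ps])) links; last by apply/allP.
  move=> P Q Pps _ /= fPQ; rewrite /e fPQ andbT; apply/orP; right.
  exact: (map_f (fun P => last P.1 P.2)).
exists M; rewrite size_ps addKn -size_ps.
apply: leq_trans (_ : _ <= \sum_x #|V|.+1 * (x \in lasts)) _.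
  apply: leq_sum => x _.
  have /orP [/cost_arc -> //|/andP [-> /eqP fx]] := eM x.
  by rewrite (cost_inside extD fx) muln1.
rewrite -big_distrr /= leq_mul2l /=.
rewrite -[X in X <= _](_ : #|[in lasts]| = _); last first.
  by rewrite -sum1_card big_mkcond /=; apply: eq_bigr => x _; case: ifP.
by rewrite -(size_map (fun P => last P.1 P.2) ps) card_size.
Qed.

(** * Answers read off a permutation with a single orbit *)

Section Answers.
Variables (N : {perm V}) (u : V).
Hypothesis hamN : forall x, x \in porbit N u.

Let card_orbit : #|porbit N u| = #|V|.
Proof. by apply: eq_card => x; rewrite hamN. Qed.

Lemma traject_uniq : uniq (traject N u #|V|).
Proof. by rewrite -card_orbit uniq_traject_porbit. Qed.

Lemma traject_all x : x \in traject N u #|V|.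
Proof. by rewrite -card_orbit -porbit_traject. Qed.

Lemma iter_card : iter #|V| N u = u.
Proof. by rewrite -card_orbit iter_porbit. Qed.

Lemma traject_cycle : cycle (frel N) (traject N u #|V|).
Proof.
have := iter_card; have: 0 < #|V| by apply/card_gt0P; exists u.
case: #|V| => // k _ kE /=; rewrite rcons_path fpath_traject last_traject /=.
exact/eqP.
Qed.

Lemma cycle_answer : (forall x, D x (N x)) ->
  max_spanning_gcycle D f (Cycle (traject N u #|V|)).
Proof.
move=> DN; split=> [|G /spanning_gcycle_perm []]; last by rewrite /= size_traject.
split; last exact: traject_all.
split; first exact: traject_uniq.
rewrite size_traject; split; first by apply/card_gt0P; exists u.
by apply: sub_cycle traject_cycle => x y /eqP <-.
Qed.

(** Cutting the orbit after every step that is not an arc yields such pieces. *)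
Definition maximal_segment (P : V * seq V) : bool :=
  ~~ D (last P.1 P.2) (N (last P.1 P.2)) &&
  all (fun v => D v (N v)) (belast P.1 P.2).

Lemma path_maximal_segment P :
  path (frel N) P.1 P.2 -> maximal_segment P -> path D P.1 P.2.
Proof.
case: P => v p /= pN /andP [_ /=].
elim: p v pN => //= w p IH v /andP [/eqP vw pw] /andP [Dv all_p].
by rewrite -vw Dv vw IH.
Qed.

(** There are as many segments as paid steps, and by [spanning_gcycle_perm] a G-cycle with more arcs
    would give a cheaper permutation. *)
Lemma paths_answer ps : (forall M, perm_cost D N <= perm_cost D M) ->
  flatten [seq P.1 :: P.2 | P <- ps] = traject N u #|V| ->
  all maximal_segment ps -> max_spanning_gcycle D f (Paths ps).
Proof.
move=> optN flatE segs.
have size_ps : #|V| = sumn [seq size P.2 | P <- ps] + size ps.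
  by rewrite -size_flatten_paths flatE size_traject.
have nonarcs : \sum_x ~~ D x (N x) = size ps.
  rewrite -[RHS]sum1_size.
  transitivity (count (fun x => ~~ D x (N x)) (traject N u #|V|)).
    rewrite -sum1_count [RHS]big_mkcond /= [RHS]big_uniq ?traject_uniq //=.
    by apply: eq_big => x; [rewrite traject_all | case: (D x _)].
  rewrite -flatE count_flatten -!map_comp sumnE big_map.
  rewrite big_seq [RHS]big_seq; apply: eq_bigr => -[v p] /(allP segs) /andP [/= nl all_p].
  rewrite -[LHS]/(count (fun x => ~~ D x (N x)) (v :: p)) lastI -cats1 count_cat /= nl.
  by rewrite (_ : count _ _ = 0) //; apply/eqP; rewrite -leqn0 leqNgt -has_count
    has_predC all_p.
split=> [|G /spanning_gcycle_perm [leG [M leM]]] /=; last first.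
  have := leq_trans (optN M) leM.
  by rewrite (optimal_perm_cost optN) nonarcs leq_mul2l /= size_ps; lia.
split; last by move=> x; rewrite /= flatE traject_all.
have := traject_cycle; rewrite -flatE cycle_flatten => /andP [all_paths links].
split; first by rewrite /= flatE traject_uniq.
split.
- case: (ps) flatE; last by [].
  have: 0 < #|V| by apply/card_gt0P; exists u.
  by case: #|V|.
- by apply/allP => P Pps; exact: path_maximal_segment (allP all_paths _ Pps) (allP segs _ Pps).
- apply: (sub_in_cycle (P := [in ps])) links; last by apply/allP.
  move=> P Q /(allP segs) /andP [nD _] _ /= /eqP <-.
  by apply/eqP/(optimal_similar optN).
Qed.

End Answers.

End OptimalPermutations.

(** * Bounded loops *)

(* Programs whose only loops are bounded by the value of register 1 or 2,
   which are never assigned: they denote total functions on states, and their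
   running time is bounded by a polynomial read off their syntax. *)
Inductive fprog :=
  | FSkip
  | FAssign (r : nat) (e : expr)
  | FPut (a : nat) (e1 e2 : expr)
  | FSeq (c1 c2 : fprog)
  | FIf (b : test) (c1 c2 : fprog)
  | FFor (r b : nat) (c : fprog).

Fixpoint compile (c : fprog) : cmd :=
  match c with
  | FSkip => Skip
  | FAssign r e => Assign r e
  | FPut a e1 e2 => Put a e1 e2
  | FSeq c1 c2 => Seq (compile c1) (compile c2)
  | FIf b c1 c2 => If b (compile c1) (compile c2)
  | FFor r b c =>
      Seq (Assign r (Const 0))
        (While (Less (Reg r) (Reg b))
           (Seq (compile c) (Assign r (Add (Reg r) (Const 1)))))
  end.

Fixpoint run (c : fprog) (st : state) : state :=
  match c with
  | FSkip => st
  | FAssign r e => set_reg st r (eval st e)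
  | FPut a e1 e2 => set_arr st a (eval st e1) (eval st e2)
  | FSeq c1 c2 => run c2 (run c1 st)
  | FIf b c1 c2 => if eval_test st b then run c1 st else run c2 st
  | FFor r b c =>
      iter (reg st b)
        (fun st' => set_reg (run c st') r (reg (run c st') r + 1))
        (set_reg st r 0)
  end.

Fixpoint modified_regs (c : fprog) : seq nat :=
  match c with
  | FSkip | FPut _ _ _ => [::]
  | FAssign r _ => [:: r]
  | FSeq c1 c2 | FIf _ c1 c2 => modified_regs c1 ++ modified_regs c2
  | FFor r _ c => r :: modified_regs c
  end.

Fixpoint modified_arrs (c : fprog) : seq nat :=
  match c with
  | FSkip | FAssign _ _ => [::]
  | FPut a _ _ => [:: a]
  | FSeq c1 c2 | FIf _ c1 c2 => modified_arrs c1 ++ modified_arrs c2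
  | FFor _ _ c => modified_arrs c
  end.

Definition bounds : seq nat := [:: 1; 2].

Fixpoint well_formed (c : fprog) : bool :=
  match c with
  | FSkip | FPut _ _ _ => true
  | FAssign r _ => r \notin bounds
  | FSeq c1 c2 | FIf _ c1 c2 => well_formed c1 && well_formed c2
  | FFor r b c =>
      [&& b \in bounds, r \notin bounds, r \notin modified_regs c & well_formed c]
  end.

Lemma reg_run c st r : r \notin modified_regs c -> reg (run c st) r = reg st r.
Proof.
elim: c st => //= [r' e|c1 IH1 c2 IH2|b c1 IH1 c2 IH2|r' b c IH] st.
- by rewrite inE => /negbTE ->.
- by rewrite mem_cat negb_or => /andP [n1 n2]; rewrite IH2 ?IH1.
- by rewrite mem_cat negb_or => /andP [n1 n2]; case: ifP => _; auto.
- rewrite inE negb_or => /andP [/negbTE rr' nc].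
  by elim: (reg st b) => [|k IHk] /=; rewrite rr' // IH.
Qed.

Lemma arr_run c st a i : a \notin modified_arrs c -> arr (run c st) a i = arr st a i.
Proof.
elim: c st => //= [a' e1 e2|c1 IH1 c2 IH2|b c1 IH1 c2 IH2|r' b c IH] st.
- by rewrite inE => /negbTE ->.
- by rewrite mem_cat negb_or => /andP [n1 n2]; rewrite IH2 ?IH1.
- by rewrite mem_cat negb_or => /andP [n1 n2]; case: ifP => _; auto.
- by move=> nc; elim: (reg st b) => [|k IHk] //=; rewrite IH.
Qed.

Lemma bounds_modified c r : well_formed c -> r \in bounds -> r \notin modified_regs c.
Proof.
move=> wf rb; elim: c wf => //= [r' e|c1 IH1 c2 IH2|b c1 IH1 c2 IH2|r' b c IH].
- by rewrite mem_seq1; apply: contraNneq => <-.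
- by case/andP=> /IH1 n1 /IH2 n2; rewrite mem_cat negb_or n1.
- by case/andP=> /IH1 n1 /IH2 n2; rewrite mem_cat negb_or n1.
- case/and4P=> _ r'b _ /IH nc; rewrite inE negb_or nc andbT.
  by apply: contraNneq r'b => <-.
Qed.

(** [B] bounds the registers in [bounds]. Besides its body an iteration costs 3 for the test and 4
    for the increment; the initial assignment and the failing test cost 5. Both branches of a
    conditional are charged. *)
Fixpoint time (c : fprog) (B : nat) : nat :=
  match c with
  | FSkip => 1
  | FAssign r e => (expr_cost e).+1
  | FPut a e1 e2 => (expr_cost e1 + expr_cost e2).+1
  | FSeq c1 c2 => time c1 B + time c2 B
  | FIf b c1 c2 => test_cost b + (time c1 B + time c2 B)
  | FFor r b c => B * (time c B + 7) + 5
  end.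

Lemma exec_compile c st B : well_formed c ->
  (forall r, r \in bounds -> reg st r <= B) ->
  exists2 t, exec (compile c) st (run c st) t & t <= time c B.
Proof.
elim: c st => [|r e|a e1 e2|c1 IH1 c2 IH2|b c1 IH1 c2 IH2|r b c IH] st /=.
- by exists 1 => //; constructor.
- by exists (expr_cost e).+1 => //; constructor.
- by exists (expr_cost e1 + expr_cost e2).+1 => //; constructor.
- case/andP=> wf1 wf2 leB; have [t1 E1 le1] := IH1 st wf1 leB.
  have [|t2 E2 le2] := IH2 (run c1 st) wf2.
    by move=> r rb; rewrite reg_run ?leB // bounds_modified.
  by exists (t1 + t2); [apply: ExecSeq E1 E2 | apply: leq_add].
- case/andP=> wf1 wf2 leB; have [t1 E1 le1] := IH1 st wf1 leB.
  have [t2 E2 le2] := IH2 st wf2 leB.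
  exists (test_cost b + (if eval_test st b then t1 else t2)).
    by apply: ExecIf; case: (eval_test st b).
  by rewrite leq_add2l; case: (eval_test st b); lia.
- case/and4P=> bb rb rc wf leB.
  have br : (b == r) = false by apply: contraNF rb => /eqP <-.
  set F := fun st' => set_reg _ _ _.
  (* Here [k] is the number of iterations that remain, from a state in the middle of the loop. *)
  have loop k : forall st', (forall r, r \in bounds -> reg st' r <= B) ->
      reg st' r + k = reg st' b ->
      exists2 t, exec (While (Less (Reg r) (Reg b))
        (Seq (compile c) (Assign r (Add (Reg r) (Const 1))))) st' (iter k F st') t
      & t <= k * (time c B + 7) + 3.
    elim: k => [|k IHk] st' leB' rk.
      by exists 3 => //; apply: ExecWhileFalse => /=; rewrite -rk addn0 ltnn.
    have [t E le] := IH st' wf leB'.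
    have [||t' E' le'] := IHk (F st').
    + move=> r' r'b; rewrite /F /=; case: eqP => [rr'|_].
        by rewrite -rr' r'b in rb.
      by rewrite reg_run ?leB' ?bounds_modified.
    + rewrite /F /= eqxx br (reg_run _ rc) (reg_run _ (bounds_modified wf bb)).
      by rewrite -rk; lia.
    exists (3 + (t + 4) + t'); last by rewrite mulSn; lia.
    rewrite iterSr; apply: ExecWhileTrue E'; first by rewrite /= -rk; lia.
    by apply: ExecSeq E _; apply: ExecAssign.
  have [||t E le] := loop (reg st b) (set_reg st r 0).
  + move=> r' r'b /=; case: eqP => [rr'|_]; last exact: leB.
    by rewrite -rr' r'b in rb.
  + by rewrite /= eqxx br.
  exists (2 + t); first by apply: ExecSeq E; apply: ExecAssign.
  suff: reg st b * (time c B + 7) <= B * (time c B + 7) by lia.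
  by rewrite leq_mul2r leB ?orbT.
Qed.

Lemma time_poly c : exists K k, forall B, 0 < B -> time c B <= K * B ^ k.
Proof.
have const t : exists K k, forall B, 0 < B -> t <= K * B ^ k.
  by exists t, 0 => B _; rewrite muln1.
(* For [B > 0] the power [B ^ (k1 + k2)] dominates both [B ^ k1] and [B ^ k2]. *)
have add (t1 t2 : nat -> nat) :
    (exists K k, forall B, 0 < B -> t1 B <= K * B ^ k) ->
    (exists K k, forall B, 0 < B -> t2 B <= K * B ^ k) ->
    exists K k, forall B, 0 < B -> t1 B + t2 B <= K * B ^ k.
  move=> [K1 [k1 le1]] [K2 [k2 le2]]; exists (K1 + K2), (k1 + k2) => B B0.
  rewrite mulnDl; apply: leq_add.
    by apply: leq_trans (le1 B B0) _; rewrite expnD mulnA leq_pmulr ?expn_gt0 ?B0.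
  by apply: leq_trans (le2 B B0) _; rewrite expnD mulnCA leq_pmull ?expn_gt0 ?B0.
elim: c => [|r e|a e1 e2|c1 IH1 c2 IH2|b c1 IH1 c2 IH2|r b c IH] /=;
  try exact: const; try by apply: (add).
  by apply: (add) => //; apply: add.
apply: (add) => //; have [K [k le]] := add _ _ IH (const 7).
by exists K, k.+1 => B B0; rewrite expnS mulnCA leq_mul2l le ?orbT.
Qed.

(** The invariant rule for loops; its conditions on registers are syntactic and are settled by
    computation. *)
Lemma run_for (P : nat -> state -> Prop) r b c st :
  r \notin b :: modified_regs c -> b \notin modified_regs c ->
  P 0 (set_reg st r 0) ->
  (forall i s, i < reg st b -> reg s r = i -> reg s b = reg st b -> P i s ->
     P i.+1 (set_reg (run c s) r i.+1)) ->
  P (reg st b) (run (FFor r b c) st).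
Proof.
rewrite inE negb_or => /andP [rb rc] bc P0 PS /=.
set F := fun st' => set_reg _ _ _.
have: forall k, k <= reg st b -> let s := iter k F (set_reg st r 0) in
    [/\ reg s r = k, reg s b = reg st b & P k s].
  elim=> [_|k IH /= kb]; first by rewrite /= eqxx eq_sym (negbTE rb).
  case: (IH (ltnW kb)) => /=; set s := iter k F _ => sr sb Ps.
  rewrite eqxx eq_sym (negbTE rb) !reg_run // sr sb; split=> //; first by lia.
  by rewrite /F (reg_run _ rc) sr addn1; apply: PS.
by move/(_ _ (leqnn _)) => [].
Qed.

(** * The auction as a program *)

Lemma run_seq c1 c2 st : run (FSeq c1 c2) st = run c2 (run c1 st).
Proof. by []. Qed.

Lemma run_if b c1 c2 st :
  run (FIf b c1 c2) st = if eval_test st b then run c1 st else run c2 st.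
Proof. by []. Qed.

Lemma reg_set_reg_neq st r r' v : r' != r -> reg (set_reg st r v) r' = reg st r'.
Proof. by rewrite /= => /negbTE ->. Qed.

Local Infix ";;" := FSeq (at level 61, right associativity).

Local Notation rOut := 0.
Local Notation rN := 1.
Local Notation rQ := 2.
Local Notation rQ2 := 3.
Local Notation rBidder := 4.
Local Notation rX := 5.
Local Notation rBest := 6.
Local Notation rMin := 7.
Local Notation rY := 8.
Local Notation rCost := 9.
Local Notation rPass := 12.
Local Notation rP1 := 13.
Local Notation rP2 := 14.
Local Notation rP3 := 15.
Local Notation rP4 := 16.
Local Notation rTmp := 20.
Local Notation rCur := 21.
Local Notation rFree := 26.
Local Notation rHead := 27.
Local Notation rPos := 28.

Local Notation aIn := 0.
Local Notation aRow := 1.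
Local Notation aNext := 2.
Local Notation aOwner := 3.
Local Notation aPrice := 4.
Local Notation aCost := 5.

(** Row offsets come from repeated addition. They start at 1 because cell 0 of the input holds [n];
    the last one, [n * n + 1], plus [2 * n] is the square of [n + 1]. *)
Definition setup : fprog :=
  FPut aRow (Const 0) (Const 1) ;;
  FFor rX rN (FPut aRow (Add (Reg rX) (Const 1)) (Add (Get aRow (Reg rX)) (Reg rN))) ;;
  FAssign rQ2 (Add (Get aRow (Reg rN)) (Add (Reg rN) (Reg rN))).

Definition cost_prog (ex ey : expr) (r : nat) : fprog :=
  FIf (Equal (Get aIn (Add (Get aRow ex) ey)) (Const 0))
    (FIf (Equal (Get aIn (Add (Get aRow ey) ex)) (Const 0))
      (FAssign r (Reg rQ)) (FAssign r (Reg rQ2)))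
    (FAssign r (Const 0)).

(** The value [n] in [rBidder] signals that every vertex is assigned. *)
Definition find_bidder : fprog :=
  FAssign rBidder (Reg rN) ;;
  FFor rX rN (FIf (Equal (Get aNext (Reg rX)) (Const 0))
                (FAssign rBidder (Reg rX)) FSkip).

Definition find_best : fprog :=
  FAssign rBest (Const 0) ;;
  cost_prog (Reg rBidder) (Const 0) rMin ;;
  FAssign rMin (Add (Reg rMin) (Get aPrice (Const 0))) ;;
  FFor rY rN (
    cost_prog (Reg rBidder) (Reg rY) rCost ;;
    FAssign rCost (Add (Reg rCost) (Get aPrice (Reg rY))) ;;
    FIf (Less (Reg rCost) (Reg rMin))
      (FAssign rBest (Reg rY) ;; FAssign rMin (Reg rCost)) FSkip).

(* Vertices are stored in [aNext] and [aOwner] shifted by one, 0 meaning that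
   there is none. *)
Definition place_bid : fprog :=
  FIf (Less (Const 0) (Get aOwner (Reg rBest)))
    (FPut aNext (Defs.Sub (Get aOwner (Reg rBest)) (Const 1)) (Const 0)) FSkip ;;
  FPut aOwner (Reg rBest) (Add (Reg rBidder) (Const 1)) ;;
  FPut aNext (Reg rBidder) (Add (Reg rBest) (Const 1)) ;;
  FPut aPrice (Reg rBest) (Add (Get aPrice (Reg rBest)) (Const 1)).

Definition round : fprog :=
  find_bidder ;;
  FIf (Less (Reg rBidder) (Reg rN)) (find_best ;; place_bid) FSkip.

(** The nested loops make [(n + 1) ^ 3] rounds, idle once all vertices are assigned. The last loop
    removes the shift by one from [aNext]. *)
Definition auction : fprog :=
  FFor 10 rQ (FFor 11 rQ (FFor 12 rQ round)) ;;
  FFor rX rN (FPut aNext (Reg rX) (Defs.Sub (Get aNext (Reg rX)) (Const 1))).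


(** * Correctness of the auction program *)

Section Verification.
Variables (n : nat) (D : digraph 'I_n).

(** All phases between [setup] and the output preserve this; [keeps_static] checks it on the
    syntax. *)
Record static (st : state) : Prop := Static {
  static_n : reg st rN = n;
  static_q : reg st rQ = n.+1;
  static_q2 : reg st rQ2 = n.+1 ^ 2;
  static_row : forall x, x <= n -> arr st aRow x = (x * n).+1;
  static_arc : forall x y : 'I_n, arr st aIn ((x * n).+1 + y) = D x y
}.

Lemma static_eq st st' :
  (forall r, r \in [:: rN; rQ; rQ2] -> reg st' r = reg st r) ->
  (forall a i, a \in [:: aIn; aRow] -> arr st' a i = arr st a i) ->
  static st -> static st'.
Proof.
move=> eq_r eq_a [n_st q_st q2_st row_st arc_st].
by split=> *; rewrite ?eq_r ?eq_a //; auto.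
Qed.

Definition keeps_static (c : fprog) : bool :=
  ~~ has [in [:: rN; rQ; rQ2]] (modified_regs c) &&
  ~~ has [in [:: aIn; aRow]] (modified_arrs c).

Lemma static_run c st : keeps_static c -> static st -> static (run c st).
Proof.
move=> /andP [/hasPn kr /hasPn ka]; apply: static_eq => [r rin | a i ain].
  by apply: reg_run; apply: contraTN rin => /kr.
by apply: arr_run; apply: contraTN ain => /ka.
Qed.

Lemma static_set_reg r v st :
  r \notin [:: rN; rQ; rQ2] -> static st -> static (set_reg st r v).
Proof.
by move=> nr; apply: static_eq => // r' /=; case: eqP => // ->; rewrite (negbTE nr).
Qed.

Lemma run_cost_prog st ex ey r (x y : 'I_n) : static st ->
  eval st ex = x -> eval st ey = y ->
  run (cost_prog ex ey r) st = set_reg st r (cost D x y).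
Proof.
move=> [n_st q_st q2_st row_st arc_st] /= -> ->.
rewrite !row_st; try exact: ltnW. rewrite !arc_st q_st q2_st /cost card_ord.
by case: (D x y); case: (D y x).
Qed.

Lemma for_ordinals (P : nat -> state -> Prop) r c st :
  reg st rN = n -> r \notin rN :: modified_regs c -> rN \notin modified_regs c ->
  P 0 (set_reg st r 0) ->
  (forall (x : 'I_n) s, reg s r = x -> P x s -> P x.+1 (set_reg (run c s) r x.+1)) ->
  P n (run (FFor r rN c) st).
Proof.
move=> st_n nr nc P0 PS; rewrite -[X in P X]st_n; apply: run_for => //.
by rewrite st_n => i s lt_i si _; apply: (PS (Ordinal lt_i)).
Qed.

Lemma for_vertices (P : nat -> state -> Prop) r c st :
  static st -> r \notin [:: rN; rQ; rQ2] ++ modified_regs c -> rN \notin modified_regs c ->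
  P 0 (set_reg st r 0) ->
  (forall (x : 'I_n) s, reg s r = x -> P x s -> P x.+1 (set_reg (run c s) r x.+1)) ->
  P n (run (FFor r rN c) st).
Proof.
move=> st_st; rewrite mem_cat negb_or => /andP [nr rc].
apply: for_ordinals; first exact: static_n st_st.
by rewrite inE negb_or rc andbT; apply: contraNneq nr => ->.
Qed.

Definition code (o : option 'I_n) : nat := if o is Some x then x.+1 else 0.

Record market (st : state) (mu om : 'I_n -> option 'I_n) (p : 'I_n -> nat) : Prop :=
  Market {
    market_static : static st;
    market_next : forall x : 'I_n, arr st aNext x = code (mu x);
    market_owner : forall y : 'I_n, arr st aOwner y = code (om y);
    market_price : forall y : 'I_n, arr st aPrice y = p y
  }.

Lemma market_run c st mu om p : keeps_static c ->
  ~~ has [in [:: aNext; aOwner; aPrice]] (modified_arrs c) ->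
  market st mu om p -> market (run c st) mu om p.
Proof.
move=> kc /hasPn ka [st_st nx ow pr].
have ka' a : a \in [:: aNext; aOwner; aPrice] -> a \notin modified_arrs c.
  by move=> ain; apply: contraTN ain => /ka.
by split=> [|x|x|x]; rewrite ?arr_run ?ka' //; apply: static_run.
Qed.

Lemma market_set_reg r v st mu om p :
  r \notin [:: rN; rQ; rQ2] -> market st mu om p -> market (set_reg st r v) mu om p.
Proof. by move=> nr [st_st nx ow pr]; split=> //; apply: static_set_reg. Qed.

Lemma run_find_bidder st mu om p : market st mu om p ->
  (reg (run find_bidder st) rBidder = n /\ forall x, mu x != None) \/
  exists x : 'I_n, reg (run find_bidder st) rBidder = x /\ mu x = None.
Proof.
move=> mk; rewrite /find_bidder run_seq; set s0 := run _ st.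
have mk0 : market s0 mu om p by apply: market_run mk.
pose P i s := market s mu om p /\
  ((reg s rBidder = n /\ forall x : 'I_n, x < i -> mu x != None) \/
   exists x : 'I_n, reg s rBidder = x /\ mu x = None).
have [] // : P n (run (FFor rX rN (FIf (Equal (Get aNext (Reg rX)) (Const 0))
                (FAssign rBidder (Reg rX)) FSkip)) s0).
  apply: for_vertices => //; first exact: market_static mk0.
    split; first exact: market_set_reg.
    by left; rewrite /= (static_n (market_static mk)); split.
  move=> x s sx [mks IH]; split.
    by apply: market_set_reg => //; apply: market_run mks.
  rewrite /= sx (market_next mks).
  case mux: (mu x) => [y|] /=; last by right; exists x.
  case: IH => [[sn all_x]|]; last by right.
  left; split=> // x'; rewrite ltnS leq_eqVlt => /orP [/eqP/val_inj -> |/all_x //].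
  by rewrite mux.
move=> _ [[sn all_x]|]; last by right.
by left; split=> // x; apply: all_x.
Qed.

Lemma run_find_best st mu om p (x : 'I_n) : market st mu om p ->
  reg st rBidder = x ->
  exists y : 'I_n, reg (run find_best st) rBest = y /\
    forall y', cost D x y + p y <= cost D x y' + p y'.
Proof.
move=> mk stx; have n_gt0 : 0 < n := leq_ltn_trans (leq0n x) (ltn_ord x).
pose P i s := [/\ market s mu om p, reg s rBidder = x
  & exists y : 'I_n, [/\ reg s rBest = y, reg s rMin = cost D x y + p y
    & forall y' : 'I_n, y' < i -> cost D x y + p y <= cost D x y' + p y']].
rewrite /find_best run_seq run_seq.
rewrite (@run_cost_prog _ _ _ _ x (Ordinal n_gt0)) //; last first.
  by apply: static_set_reg; [|exact: market_static mk].
set s1 := set_reg _ _ _; rewrite run_seq; set s2 := run _ s1.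
set loop := FFor _ _ _.
have mk2 : market s2 mu om p by rewrite /s2 /s1 /=; do 3!apply: market_set_reg => //.
have [] : P n (run loop s2).
  apply: for_vertices => //; first exact: market_static mk2.
    split=> //; first exact: market_set_reg.
    exists (Ordinal n_gt0); split=> //=.
    by rewrite -(market_price mk).
  move=> y s sy [mks sx [b [sb sm min_b]]].
  split; [|by rewrite reg_set_reg_neq // reg_run|].
    by apply: market_set_reg => //; apply: market_run mks.
  rewrite run_seq (@run_cost_prog _ _ _ _ x y) //; last exact: market_static mks.
  rewrite run_seq /= sy sm (market_price mks).
  case: ltnP => [lt|ge] /=; [exists y | exists b]; rewrite ?sy; split=> // y'.
    rewrite ltnS leq_eqVlt => /orP [/eqP/val_inj -> //|/min_b].
    by apply: leq_trans; apply: ltnW.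
  by rewrite ltnS leq_eqVlt => /orP [/eqP/val_inj -> //|/min_b].
by move=> _ _ [y [yE _ min_y]]; exists y; split=> // y'; apply: min_y.
Qed.

Lemma run_place_bid st mu om p (x y : 'I_n) : market st mu om p ->
  reg st rBidder = x -> reg st rBest = y -> mu x = None ->
  market (run place_bid st) (bid_mu mu om x y) (bid_om om x y) (bid_price p y).
Proof.
move=> mk stx sty mux.
split; first by apply: static_run => //; exact: market_static mk.
- move=> z; rewrite /place_bid /bid_mu /= sty (market_owner mk).
  case omy: (om y) => [w|] /=; rewrite ?sty stx ?subn1 /= !val_eqE addn1 (market_next mk).
    by rewrite (inj_eq (@Some_inj _)) [z == w]eq_sym; case: (z == x); case: (w == z).
  by case: (z == x).
- move=> z; rewrite /place_bid /bid_om /= sty (market_owner mk).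
  by case: (om y) => [w|] /=; rewrite ?sty ?stx val_eqE addn1 (market_owner mk);
    case: eqVneq.
- move=> z; rewrite /place_bid /bid_price /= sty (market_owner mk).
  by case: (om y) => [w|] /=; rewrite ?sty ?stx val_eqE !(market_price mk) addn1;
    case: eqVneq => // ->.
Qed.

(** Here [m] counts rounds: a round that finds a free bidder adds one to the sum of the prices. *)
Definition auction_progress (m : nat) (st : state) : Prop :=
  exists mu om p, [/\ market st mu om p, auction_inv D mu om p
    & (forall x, mu x != None) \/ m <= \sum_y p y].

Lemma auction_progress_round m st :
  auction_progress m st -> auction_progress m.+1 (run round st).
Proof.
move=> [mu [om [p [mk inv prog]]]]; rewrite /round run_seq.
have := run_find_bidder mk; set s := run find_bidder st => bidder.
have mks : market s mu om p by apply: market_run mk.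
rewrite run_if [eval_test _ _]/= (static_n (market_static mks)).
case: bidder => [[-> all_x]|[x [sx mux]]].
  by rewrite ltnn; exists mu, om, p; split=> //; left.
rewrite sx ltn_ord run_seq; have [y [sy best]] := run_find_best mks sx.
exists (bid_mu mu om x y), (bid_om om x y), (bid_price p y); split.
- apply: run_place_bid => //; first exact: market_run mks.
  by rewrite reg_run.
- exact: auction_inv_bid.
- case: prog => [/(_ x)|le_m]; first by rewrite mux.
  by right; rewrite sum_bid_price.
Qed.

(** The body accounts for [k] rounds, so nesting loops multiplies the counts. *)
Lemma auction_progress_for r c k m st :
  r \notin [:: rN; rQ; rQ2] ++ modified_regs c -> rQ \notin modified_regs c ->
  static st ->
  (forall m s, auction_progress m s -> auction_progress (m + k) (run c s)) ->
  auction_progress m st -> auction_progress (m + n.+1 * k) (run (FFor r rQ c) st).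
Proof.
rewrite mem_cat negb_or => /andP [nr rc] nc st_st prog_c prog.
have set_prog m' s v : auction_progress m' s -> auction_progress m' (set_reg s r v).
  move=> [mu [om [p [mk inv pr]]]]; exists mu, om, p; split=> //.
  exact: market_set_reg.
rewrite -[n.+1](static_q st_st).
apply: (run_for (P := fun i => auction_progress (m + i * k))) => //.
- by rewrite inE negb_or rc andbT; apply: contraNneq nr => ->.
- by rewrite addn0; apply: set_prog.
- by move=> i s _ _ _ /prog_c; rewrite -addnA -mulSnr; apply: set_prog.
Qed.

Definition stores (st : state) (N : {perm 'I_n}) : Prop :=
  static st /\ forall x : 'I_n, arr st aNext x = N x.

Lemma run_auction st : static st ->
  (forall a i, 2 <= a -> arr st a i = 0) ->
  exists N, stores (run auction st) N /\ forall M, perm_cost D N <= perm_cost D M.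
Proof.
move=> st_st empty.
have prog0 : auction_progress 0 st.
  exists (fun _ => None), (fun _ => None), (fun _ => 0).
  by split; [split=> // x; rewrite empty | split | right].
have prog_static m s : auction_progress m s -> static s.
  by case=> mu [om [p [mk _ _]]]; exact: market_static mk.
have prog3 : auction_progress (n.+1 ^ 3)
    (run (FFor 10 rQ (FFor 11 rQ (FFor 12 rQ round))) st).
  have -> : n.+1 ^ 3 = 0 + n.+1 * (n.+1 * (n.+1 * 1)) by rewrite !expnS expn0.
  apply: auction_progress_for => // m s prog.
  apply: auction_progress_for => //; first exact: prog_static prog.
  move=> {prog}m {}s prog.
  apply: auction_progress_for => //; first exact: prog_static prog.
  by move=> {prog}m {}s; rewrite addn1; apply: auction_progress_round.
rewrite /auction run_seq; move: prog3; set s0 := run _ st.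
move=> [mu [om [p [mk inv sold]]]].
have {sold} : forall x, mu x != None.
  case: sold => // le_sum; have := auction_sum_price inv.
  by rewrite card_ord ltnNge le_sum.
move/(auction_perm inv) => [N muN]; exists N; split; last exact: auction_optimal inv muN.
split; first by apply: static_run => //; exact: market_static mk.
move=> x; set loop := FFor _ _ _.
pose P i s := forall x : 'I_n, arr s aNext x = if x < i then val (N x) else (N x).+1.
suff: P n (run loop s0) by move=> ->; rewrite ltn_ord.
apply: for_vertices => //; first exact: market_static mk.
  by move=> y; rewrite /= (market_next mk) muN.
move=> y s sy Ps z; rewrite /= sy !Ps val_eqE ltnS.
have [-> | zy] := eqVneq z y; first by rewrite ltnn leqnn subn1.
by rewrite [z <= y]leq_eqVlt val_eqE (negbTE zy).
Qed.

End Verification.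

(** * The merging program *)

Local Notation rTotal := 22.
Local Notation rLength := 23.
Local Notation rTotal0 := 24.
Local Notation rLength0 := 25.

(** The walk along the orbit of vertex 0 starts at its successor with length 1 and stays put once
    back at 0, so [n] iterations always suffice. *)
Definition measure : fprog :=
  FAssign rTotal (Const 0) ;;
  FFor rX rN (cost_prog (Reg rX) (Get aNext (Reg rX)) rCost ;;
              FAssign rTotal (Add (Reg rTotal) (Reg rCost))) ;;
  FAssign rLength (Const 1) ;;
  FAssign rCur (Get aNext (Const 0)) ;;
  FFor rX rN (FIf (Equal (Reg rCur) (Const 0)) FSkip
                (FAssign rLength (Add (Reg rLength) (Const 1)) ;;
                 FAssign rCur (Get aNext (Reg rCur)))).

Definition swap (p q : nat) : fprog :=
  FAssign rTmp (Get aNext (Reg p)) ;;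
  FPut aNext (Reg p) (Get aNext (Reg q)) ;;
  FPut aNext (Reg q) (Reg rTmp).

(** Each swap multiplies the stored permutation on the left by a transposition; the three build
    [cyclic_shift], and [unshift] undoes them in reverse order. *)
Definition shift : fprog := swap rP1 rP2 ;; swap rP2 rP3 ;; swap rP3 rP4.
Definition unshift : fprog := swap rP3 rP4 ;; swap rP2 rP3 ;; swap rP1 rP2.

Definition try_shift : fprog :=
  measure ;;
  FAssign rTotal0 (Reg rTotal) ;;
  FAssign rLength0 (Reg rLength) ;;
  shift ;;
  measure ;;
  FIf (Less (Reg rTotal0) (Reg rTotal)) unshift
    (FIf (Less (Reg rLength0) (Reg rLength)) FSkip unshift).

(** Coinciding values of the four counters cover the exchanges of two and of three successors. *)
Definition pass : fprog :=
  FFor rP1 rN (FFor rP2 rN (FFor rP3 rN (FFor rP4 rN try_shift))).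

Definition merge_cycles : fprog := FFor rPass rN pass.

(** * Correctness of the merging program *)

Section MergeVerification.
Variables (n : nat) (D : digraph 'I_n) (z : 'I_n).
Hypothesis z0 : z = 0 :> nat.
Implicit Types N M : {perm 'I_n}.

Lemma stores_run c st N : keeps_static c -> aNext \notin modified_arrs c ->
  stores D st N -> stores D (run c st) N.
Proof.
move=> kc nc [st_st nx]; split; first exact: static_run.
by move=> x; rewrite arr_run.
Qed.

Lemma stores_set_reg r v st N : r \notin [:: rN; rQ; rQ2] ->
  stores D st N -> stores D (set_reg st r v) N.
Proof. by move=> nr [st_st nx]; split=> //; apply: static_set_reg. Qed.

Lemma iter_porbit_neq N i : 0 < i < #|porbit N z| -> iter i N z != z.
Proof.
move=> /andP [i0 iL]; have L0 := leq_ltn_trans (leq0n i) iL.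
rewrite -(nth_traject N iL) -[X in _ != X](nth_traject N L0 z).
by rewrite nth_uniq ?size_traject ?uniq_traject_porbit // -lt0n.
Qed.

Lemma run_measure st N : stores D st N ->
  reg (run measure st) rTotal = perm_cost D N /\
  reg (run measure st) rLength = #|porbit N z|.
Proof.
move=> sto; rewrite /measure !run_seq; set s0 := run _ st.
set loop1 := FFor _ _ (FSeq _ _); set s1 := run loop1 s0.
set s2 := run _ (run _ s1); set loop2 := FFor _ _ _.
have sto0 : stores D s0 N by apply: stores_run sto.
have sto1 : stores D s1 N by apply: stores_run sto0.
have sto2 : stores D s2 N by do 2!apply: stores_run => //.
split.
  rewrite /s2 3?reg_run //.
  pose P i s := stores D s N /\
    reg s rTotal = \sum_(x : 'I_n | x < i) cost D x (N x).
  have [_ ->] : P n s1.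
    apply: (for_vertices (D := D)) => //; first by case: sto0.
      by split; [apply: stores_set_reg | rewrite /= big_pred0].
    move=> x s sx [stos sum_s]; split.
      by apply: stores_set_reg => //; apply: stores_run stos.
    rewrite run_seq (@run_cost_prog _ D _ _ _ _ x (N x)) //=; try by case: stos.
      rewrite sum_s [in RHS](bigD1 x) //= [RHS]addnC; congr (_ + _).
      by apply: eq_bigl => w; rewrite ltnS ltn_neqAle andbC.
    by rewrite sx; case: stos.
  by apply: eq_bigl => x; rewrite ltn_ord.
set L := #|_|; have L0 : 0 < L by apply/card_gt0P; exists z; apply: porbit_id.
(* The counter saturates at the orbit length [L], where the walk is back at [z]. *)
pose P i s := [/\ stores D s N, reg s rLength = minn i.+1 L
  & reg s rCur = iter (minn i.+1 L) N z].
have [] : P n (run loop2 s2).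
  apply: (for_vertices (D := D)) => //; first by case: sto2.
    split=> //=; first exact: stores_set_reg.
      by rewrite (minn_idPl L0).
    by rewrite (minn_idPl L0) /=; case: sto1 => _ /(_ z); rewrite z0.
  move=> x s _ [stos sl sc].
  have zE (w : 'I_n) : (nat_of_ord w == 0) = (w == z).
    by rewrite -(inj_eq val_inj) /= z0.
  have next_length : minn x.+2 L =
      if iter (minn x.+1 L) N z == z then minn x.+1 L else (minn x.+1 L).+1.
    case: eqP => [loop|/eqP no_loop].
      have: ~~ (0 < minn x.+1 L < L).
        by apply: contraL (eqxx z) => /iter_porbit_neq; rewrite loop.
      by lia.
    have: minn x.+1 L != L by apply: contraNneq no_loop => ->; rewrite iter_porbit.
    by lia.
  split.
  - by apply: stores_set_reg => //; apply: stores_run stos.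
  - rewrite next_length reg_set_reg_neq // run_if [eval_test _ _]/= sc zE.
    by case: ifP => _ //=; rewrite sl addn1.
  - rewrite next_length reg_set_reg_neq // run_if [eval_test _ _]/= sc zE.
    by case: ifP => _ //=; rewrite sc; case: stos => _ ->.
by move=> _ -> _; apply/minn_idPr; rewrite ltnW // ltnS -[n in _ <= n]card_ord max_card.
Qed.

Lemma run_swap st N p q (x y : 'I_n) : stores D st N ->
  p != rTmp -> q != rTmp -> reg st p = x -> reg st q = y ->
  stores D (run (swap p q) st) (tperm x y * N)%g.
Proof.
move=> [st_st nx] pt qt px qy; split; first exact: static_run.
move=> w; rewrite /= (negbTE pt) (negbTE qt) px qy !nx !val_eqE permM.
case: tpermP => [->|->|/eqP/negbTE -> /eqP/negbTE -> //].
  by rewrite eqxx; case: eqVneq => // ->.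
by rewrite eqxx.
Qed.

Definition at_tuple (st : state) (x1 x2 x3 x4 : 'I_n) : Prop :=
  [/\ reg st rP1 = x1, reg st rP2 = x2, reg st rP3 = x3 & reg st rP4 = x4].

Lemma at_tuple_run c st x1 x2 x3 x4 :
  ~~ has [in [:: rP1; rP2; rP3; rP4]] (modified_regs c) ->
  at_tuple st x1 x2 x3 x4 -> at_tuple (run c st) x1 x2 x3 x4.
Proof.
move=> /hasPn kc [e1 e2 e3 e4].
have keep r : r \in [:: rP1; rP2; rP3; rP4] -> reg (run c st) r = reg st r.
  by move=> rin; apply: reg_run; apply: contraTN rin => /kc.
by split; rewrite keep.
Qed.

Lemma run_shift st N x1 x2 x3 x4 : stores D st N -> at_tuple st x1 x2 x3 x4 ->
  stores D (run shift st) (cyclic_shift N x1 x2 x3 x4).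
Proof.
move=> sto [e1 e2 e3 e4]; rewrite /shift !run_seq.
by do 3!(apply: run_swap; rewrite ?reg_run //).
Qed.

Lemma run_unshift st N x1 x2 x3 x4 : at_tuple st x1 x2 x3 x4 ->
  stores D st (cyclic_shift N x1 x2 x3 x4) -> stores D (run unshift st) N.
Proof.
move=> [e1 e2 e3 e4] sto.
have -> : N = (tperm x1 x2 * (tperm x2 x3 *
    (tperm x3 x4 * cyclic_shift N x1 x2 x3 x4)))%g.
  by apply/permP => w; rewrite /cyclic_shift !permM !tpermK.
rewrite /unshift !run_seq.
by do 3!(apply: run_swap; rewrite ?reg_run //).
Qed.

Lemma run_try_shift st N x1 x2 x3 x4 : stores D st N -> at_tuple st x1 x2 x3 x4 ->
  stores D (run try_shift st)
    (if grows D z N (cyclic_shift N x1 x2 x3 x4) then cyclic_shift N x1 x2 x3 x4 else N).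
Proof.
move=> sto tup; set M := cyclic_shift N x1 x2 x3 x4; rewrite /try_shift 5!run_seq.
have := run_measure sto.
have := at_tuple_run (c := measure) isT tup.
have := stores_run (c := measure) isT isT sto.
move: (run measure st) => s1 sto1 tup1 [total length].
set s2 := run (FAssign rLength0 _) _.
have t2 : reg s2 rTotal0 = perm_cost D N by rewrite -total.
have l2 : reg s2 rLength0 = #|porbit N z| by rewrite -length.
have sto2 : stores D s2 N by do 2!apply: stores_run => //.
have tup2 : at_tuple s2 x1 x2 x3 x4 by do 2!apply: at_tuple_run => //.
move: s2 => s2 in t2 l2 sto2 tup2 *.
have := run_shift sto2 tup2.
have := at_tuple_run (c := shift) isT tup2.
have: reg (run shift s2) rTotal0 = perm_cost D N by rewrite -t2; apply: reg_run.
have: reg (run shift s2) rLength0 = #|porbit N z| by rewrite -l2; apply: reg_run.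
move: (run shift s2) => s3 l3 t3 tup3 sto3.
have := run_measure sto3.
have := at_tuple_run (c := measure) isT tup3.
have := stores_run (c := measure) isT isT sto3.
have: reg (run measure s3) rTotal0 = perm_cost D N by rewrite -t3; apply: reg_run.
have: reg (run measure s3) rLength0 = #|porbit N z| by rewrite -l3; apply: reg_run.
move: (run measure s3) => s4 l4 t4 sto4 tup4 [total' length'].
have stoU := run_unshift tup4 sto4.
rewrite -/M in total' length'.
rewrite run_if [eval_test _ _]/= t4 total' ltnNge /grows.
case: (leqP (perm_cost D M)) => // _; rewrite run_if [eval_test _ _]/= l4 length'.
by case: ltnP.
Qed.

Lemma grows_trans N M L : grows D z N M -> grows D z M L -> grows D z N L.
Proof.
move=> /andP [cNM oNM] /andP [cML oML].
by rewrite /grows (leq_trans cML cNM) (ltn_trans oNM oML).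
Qed.

Definition grown N (st : state) : Prop := exists2 M, stores D st M & grows D z N M.

Definition same_or_grown N (st : state) : Prop := stores D st N \/ grown N st.

(* Whatever the values of the registers [rs] the program [c] does no harm, and
   if [good] it makes the orbit of [z] grow when these values are [qs]. *)
Definition progressing N (good : bool) (c : fprog) (rs : seq nat)
    (qs : seq 'I_n) : Prop :=
  forall st (xs : seq 'I_n), [seq reg st r | r <- rs] = [seq val x | x <- xs] ->
    [/\ same_or_grown N st -> same_or_grown N (run c st),
        grown N st -> grown N (run c st)
      & good -> xs = qs -> same_or_grown N st -> grown N (run c st)].

Lemma same_or_grown_set_reg N r v st : r \notin [:: rN; rQ; rQ2] ->
  same_or_grown N st -> same_or_grown N (set_reg st r v).
Proof.
move=> nr [sto|[M sto gM]]; [left | right; exists M] => //;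
  exact: stores_set_reg.
Qed.

Lemma grown_set_reg N r v st : r \notin [:: rN; rQ; rQ2] ->
  grown N st -> grown N (set_reg st r v).
Proof. by move=> nr [M sto gM]; exists M => //; apply: stores_set_reg. Qed.

Lemma progressing_try N (q1 q2 q3 q4 : 'I_n) :
  progressing N (grows D z N (cyclic_shift N q1 q2 q3 q4)) try_shift [:: rP4; rP3; rP2; rP1] [:: q4; q3; q2; q1].
Proof.
move=> st xs xsE.
have [x4 [x3 [x2 [x1 [-> tup]]]]] : exists x4 x3 x2 x1,
    xs = [:: x4; x3; x2; x1] /\ at_tuple st x1 x2 x3 x4.
  case: xs xsE => [|x4 [|x3 [|x2 [|x1 [|? ?]]]]] //= [? ? ? ?].
  by exists x4, x3, x2, x1.
have grown_run : grown N st -> grown N (run try_shift st).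
  case=> M sto gM; have := run_try_shift sto tup; case: ifP => [gL|_] sto'.
    by exists (cyclic_shift M x1 x2 x3 x4); rewrite ?(grows_trans gM gL).
  by exists M.
split=> //.
- case=> [sto|/grown_run]; last by right.
  have := run_try_shift sto tup; case: ifP => gM sto'; last by left.
  by right; exists (cyclic_shift N x1 x2 x3 x4).
- move=> gq [? ? ? ?] [sto|/grown_run //]; subst.
  have := run_try_shift sto tup; rewrite gq => sto'.
  by exists (cyclic_shift N q1 q2 q3 q4).
Qed.

(** Earlier iterations do no harm, the one with counter [q] makes the orbit grow if it has not grown
    yet, and later ones preserve this. *)
Lemma progressing_for N good c r rs q qs : r \notin [:: rN; rQ; rQ2] ++ modified_regs c ->
  rN \notin modified_regs c -> ~~ has [in r :: modified_regs c] rs ->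
  progressing N good c (r :: rs) (q :: qs) ->
  progressing N good (FFor r rN c) rs qs.
Proof.
move=> nr nc /hasPn rsP prog st xs xsE.
have [nr' _] : r \notin [:: rN; rQ; rQ2] /\ True.
  by move: nr; rewrite mem_cat negb_or => /andP [].
have static_sg s : same_or_grown N s -> static D s by case=> [[]|[M []]].
have rsE s v : [seq reg s r' | r' <- rs] = [seq val x | x <- xs] ->
    [seq reg (set_reg s r v) r' | r' <- rs] = [seq val x | x <- xs].
  move=> <-; apply/eq_in_map => r' /rsP; rewrite inE negb_or => /andP [ne _].
  exact: reg_set_reg_neq.
have rsE' s v : [seq reg s r' | r' <- rs] = [seq val x | x <- xs] ->
    [seq reg (set_reg (run c s) r v) r' | r' <- rs] = [seq val x | x <- xs].
  move=> sE; apply: rsE; rewrite -sE; apply/eq_in_map => r' /rsP.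
  by rewrite inE negb_or => /andP [_]; apply: reg_run.
have step (x : 'I_n) s : reg s r = x -> [seq reg s r' | r' <- rs] = [seq val x | x <- xs] ->
    [seq reg s r' | r' <- r :: rs] = [seq val x | x <- x :: xs].
  by move=> /= -> ->.
split.
- move=> sg; pose P (i : nat) s :=
    [seq reg s r' | r' <- rs] = [seq val x | x <- xs] /\ same_or_grown N s.
  suff [] : P n (run (FFor r rN c) st) by [].
  apply: for_vertices (static_sg _ sg) nr nc _ _.
    by split; [apply: rsE | apply: same_or_grown_set_reg].
  move=> x s sx [sE sgs]; split; first exact: rsE'.
  by apply: same_or_grown_set_reg => //; have [/(_ sgs)] := prog s _ (step _ _ sx sE).
- move=> sg; pose P (i : nat) s :=
    [seq reg s r' | r' <- rs] = [seq val x | x <- xs] /\ grown N s.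
  suff [] : P n (run (FFor r rN c) st) by [].
  apply: for_vertices (static_sg _ (or_intror sg)) nr nc _ _.
    by split; [apply: rsE | apply: grown_set_reg].
  move=> x s sx [sE sgs]; split; first exact: rsE'.
  by apply: grown_set_reg => //; have [_ /(_ sgs)] := prog s _ (step _ _ sx sE).
- move=> gd xsq sg; pose P (i : nat) s :=
    [/\ [seq reg s r' | r' <- rs] = [seq val x | x <- xs], same_or_grown N s
      & q < i -> grown N s].
  suff [_ _] : P n (run (FFor r rN c) st) by apply.
  apply: for_vertices (static_sg _ sg) nr nc _ _.
    by split=> //; [apply: rsE | apply: same_or_grown_set_reg].
  move=> x s sx [sE sgs gs]; have [sg' g' gq] := prog s _ (step _ _ sx sE).
  split; first exact: rsE'.
    by apply: same_or_grown_set_reg => //; apply: sg'.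
  rewrite ltnS leq_eqVlt => /orP [/eqP/val_inj qx|/gs gs']; apply: grown_set_reg => //.
    by apply: gq => //; rewrite qx xsq.
  exact: g'.
Qed.

Lemma run_pass st N q1 q2 q3 q4 : stores D st N ->
  same_or_grown N (run pass st) /\
  (grows D z N (cyclic_shift N q1 q2 q3 q4) -> grown N (run pass st)).
Proof.
move=> sto.
have prog : progressing N (grows D z N (cyclic_shift N q1 q2 q3 q4)) pass [::] [::].
  do 4!(apply: progressing_for => //).
  exact: progressing_try.
by have [H _ H'] := prog st [::] erefl; split=> [|gq]; [apply: H | apply: H'] => //; left.
Qed.

(** After [i] passes the orbit of [z] has more than [i] vertices or is everything, and [n] passes
    leave only the second case. *)
Lemma run_merge_cycles st N (s : nat) (S : digraph 'I_s) f :
  extended_semicomplete D S f -> strongly_connected D -> stores D st N ->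
  exists M, [/\ stores D (run merge_cycles st) M, perm_cost D M <= perm_cost D N
    & forall x, x \in porbit M z].
Proof.
move=> extD strD sto.
pose P i s := exists M, [/\ stores D s M, perm_cost D M <= perm_cost D N
  & i < #|porbit M z| \/ forall x, x \in porbit M z].
have [M [stoM cM orbM]] : P n (run merge_cycles st).
  apply: (for_vertices (D := D)) => //; first by case: sto.
    exists N; split=> //; first exact: stores_set_reg.
    by left; apply/card_gt0P; exists z; apply: porbit_id.
  move=> x t tx [M [stoM cM orbM]].
  have [all_x|/forallPn [y yM]] := boolP [forall y, y \in porbit M z].
    (* A full orbit cannot grow, so the pass keeps [M]; the quadruple is an arbitrary choice. *)
    have [[stoM'|[L stoL /andP [_ oL]]] _] := run_pass z z z z stoM.
      by exists M; split; [apply: stores_set_reg| |right; apply/forallP].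
    have := max_card [in porbit L z]; rewrite leqNgt (leq_trans _ oL) // ltnS.
    by apply/subset_leq_card/subsetP => y _; apply: (forallP all_x).
  have [p1 [p2 [p3 [p4 gp]]]] := exists_growing_shift extD strD (ex_intro _ y yM).
  have [_ /(_ gp) [L stoL /andP [cL oL]]] := run_pass p1 p2 p3 p4 stoM.
  exists L; split; [exact: stores_set_reg | exact: leq_trans cM | left].
  case: orbM => [lt|all_y]; first exact: leq_ltn_trans oL.
  by rewrite all_y in yM.
exists M; split=> //; case: orbM => // lt; have := max_card [in porbit M z].
by rewrite card_ord leqNgt lt.
Qed.

End MergeVerification.

(** * Writing the answer *)

(** [rFree] ends as 0 or as one more than a vertex whose step is paid. Costs are saved in [aCost]
    because the output overwrites the adjacency matrix. *)
Definition find_free : fprog :=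
  FAssign rFree (Const 0) ;;
  FFor rX rN (
    cost_prog (Reg rX) (Get aNext (Reg rX)) rCost ;;
    FPut aCost (Reg rX) (Reg rCost) ;;
    FIf (Equal (Reg rCost) (Const 0)) FSkip
      (FAssign rFree (Add (Reg rX) (Const 1)))).

Definition write_cycle : fprog :=
  FPut aIn (Const 0) (Const 1) ;;
  FAssign rCur (Const 0) ;;
  FFor rX rN (
    FPut aIn (Add (Reg rX) (Const 1)) (Reg rCur) ;;
    FAssign rCur (Get aNext (Reg rCur))) ;;
  FAssign rOut (Reg rQ).

Definition append_vertex : fprog :=
  FPut aIn (Reg rPos) (Reg rCur) ;;
  FAssign rPos (Add (Reg rPos) (Const 1)) ;;
  FPut aIn (Reg rHead) (Add (Get aIn (Reg rHead)) (Const 1)).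

Definition open_path : fprog :=
  FAssign rHead (Reg rPos) ;;
  FPut aIn (Reg rPos) (Const 0) ;;
  FAssign rPos (Add (Reg rPos) (Const 1)).

(* [rHead] is the cell that counts the vertices of the current path; a new path
   is opened after each vertex without arc to its successor, also after the
   last one, whence the final correction of the length. *)
Definition write_paths : fprog :=
  FPut aIn (Const 0) (Const 2) ;;
  FAssign rPos (Const 1) ;;
  open_path ;;
  FAssign rCur (Get aNext (Defs.Sub (Reg rFree) (Const 1))) ;;
  FFor rX rN (
    append_vertex ;;
    FIf (Equal (Get aCost (Reg rCur)) (Const 0)) FSkip open_path ;;
    FAssign rCur (Get aNext (Reg rCur))) ;;
  FAssign rOut (Defs.Sub (Reg rPos) (Const 1)).

(** For [n = 0] the input is the single entry 0, already the code of [None]. In all other cases a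
    spanning G-cycle exists and is written. *)
Definition main : fprog :=
  FIf (Equal (Reg rN) (Const 0)) FSkip (
    setup ;; auction ;; merge_cycles ;; find_free ;;
    FIf (Equal (Reg rFree) (Const 0)) write_cycle write_paths).

Lemma cost_eq0 (V : finType) (D : digraph V) x y : (cost D x y == 0) = D x y.
Proof. by rewrite /cost; case: (D x y) => //; case: (D y x). Qed.

Lemma output_assign st e :
  output (run (FAssign rOut e) st) = mkseq (arr st aIn) (eval st e).
Proof. by []. Qed.

(** * Correctness of the output *)

Section OutputVerification.
Variables (n : nat) (D : digraph 'I_n) (N : {perm 'I_n}).

Lemma run_find_free st : stores D st N ->
  (forall x : 'I_n, arr (run find_free st) aCost x = cost D x (N x)) /\
  ((reg (run find_free st) rFree = 0 /\ forall x, D x (N x)) \/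
   exists x : 'I_n, reg (run find_free st) rFree = x.+1 /\ ~~ D x (N x)).
Proof.
move=> sto; rewrite /find_free run_seq; set s0 := run _ st; set loop := FFor _ _ _.
have sto0 : stores D s0 N by apply: stores_run sto.
pose P i s := [/\ stores D s N,
  forall x : 'I_n, x < i -> arr s aCost x = cost D x (N x)
  & (reg s rFree = 0 /\ forall x : 'I_n, x < i -> D x (N x)) \/
    exists x : 'I_n, reg s rFree = x.+1 /\ ~~ D x (N x)].
suff [_ costs free] : P n (run loop s0).
  split=> [x|]; first exact: costs.
  by case: free => [[r0 all_x]|]; [left; split=> // x; apply: all_x | right].
apply: (for_vertices (D := D)) => //; first by case: sto0.
  by split=> //; [apply: stores_set_reg | left].
move=> x s sx [stos costs free]; have [st_s nx] := stos.
have ltS (y : 'I_n) : (y < x.+1) = (y == x) || (y < x).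
  by rewrite ltnS leq_eqVlt val_eqE.
split; first by apply: stores_set_reg => //; apply: stores_run stos.
- move=> y; rewrite ltS run_seq (@run_cost_prog _ D _ _ _ _ x (N x)) //=;
    last by rewrite sx nx.
  rewrite sx cost_eq0; case: (D x (N x)) => /=; rewrite val_eqE;
    by case: eqVneq => [->|] //= _; apply: costs.
- rewrite run_seq (@run_cost_prog _ D _ _ _ _ x (N x)) //=; last by rewrite sx nx.
  rewrite cost_eq0; case: ifP => [Dx|/negbT nDx] /=; last first.
    by right; exists x; rewrite sx addn1.
  case: free => [[r0 all_x]|]; last by right.
  by left; split=> // y; rewrite ltS => /orP [/eqP ->|/all_x].
Qed.

Section Hamiltonian.
Variable z : 'I_n.
Hypothesis z0 : z = 0 :> nat.

Lemma run_write_cycle st : stores D st N ->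
  output (run write_cycle st) = encode_answer (Some (Cycle (traject N z n))).
Proof.
move=> [st_st nx]; rewrite /write_cycle !run_seq.
set s0 := run _ (run _ st); set loop := FFor _ _ _.
pose P i s := [/\ forall x : 'I_n, arr s aNext x = N x,
  reg s rCur = iter i N z, arr s aIn 0 = 1
  & forall j, j < i -> arr s aIn j.+1 = iter j N z].
have [_ _ a0 aj] : P n (run loop s0).
  apply: (for_ordinals (n := n)) => //; first exact: static_n st_st.
  move=> x s sx [nxs sc s1 sj]; split=> //=; first by rewrite sc nxs.
    by rewrite sx addn1.
  move=> j; rewrite sx addn1 eqSS ltnS leq_eqVlt.
  by case: eqVneq => [->|] //= _; apply: sj.
rewrite output_assign -[eval _ _]/(reg (run loop s0) rQ) reg_run // [reg s0 _]/= (static_q st_st).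
apply: (@eq_from_nth _ 0) => [|i]; first by rewrite size_mkseq /= size_map size_traject.
rewrite size_mkseq => lt_i; rewrite nth_mkseq //.
case: i lt_i => [|i] lt_i; first by rewrite a0.
rewrite aj //= (nth_map z) ?size_traject // nth_traject //.
Qed.

End Hamiltonian.

Definition writes (st : state) (l : seq nat) : Prop :=
  forall k, k < size l -> arr st aIn k = nth 0 l k.

Lemma writes_append st l v :
  writes st l -> writes (set_arr st aIn (size l) v) (rcons l v).
Proof.
move=> wr k; rewrite size_rcons ltnS leq_eqVlt nth_rcons /= => lt_k.
by case: eqVneq lt_k => [-> _|_ /= lt_k]; rewrite ?ltnn ?eqxx // lt_k wr.
Qed.

Lemma writes_update st l1 c l2 v :
  writes st (l1 ++ c :: l2) -> writes (set_arr st aIn (size l1) v) (l1 ++ v :: l2).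
Proof.
move=> wr k lt_k; rewrite nth_cat /=; have := wr k; rewrite nth_cat /=.
rewrite size_cat /= in lt_k; rewrite size_cat /= lt_k => /(_ isT).
case: eqVneq => [-> _|ne]; first by rewrite ltnn subnn.
case: ltnP => // ge; have : 0 < k - size l1 by lia.
by case: (k - size l1).
Qed.

Definition path_code (ps : seq ('I_n * seq 'I_n)) : seq nat :=
  encode_answer (Some (Paths ps)).

(** State after [i] vertices from [u]: [ps] are the closed paths and [cur] is the open one, possibly
    still empty, with its count as header. *)
Definition writing (i : nat) (u : 'I_n) (s : state) : Prop :=
  exists ps cur,
  [/\ flatten [seq P.1 :: P.2 | P <- ps] ++ cur = traject N u i,
      all (maximal_segment D N) ps, all (fun v => D v (N v)) cur
    & [/\ writes s (path_code ps ++ size cur :: [seq val x | x <- cur]),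
          reg s rHead = size (path_code ps)
        & reg s rPos = size (path_code ps) + (size cur).+1]].

Lemma path_code_rcons ps P :
  path_code (rcons ps P) =
  path_code ps ++ (size P.2).+1 :: [seq val x | x <- P.1 :: P.2].
Proof. by rewrite /path_code /= map_rcons flatten_rcons. Qed.

Lemma writing_step i (u : 'I_n) s : writing i u s ->
  reg s rCur = iter i N u ->
  (forall x : 'I_n, arr s aCost x = cost D x (N x)) ->
  writing i.+1 u
    (run (append_vertex ;; FIf (Equal (Get aCost (Reg rCur)) (Const 0)) FSkip open_path) s).
Proof.
move=> [ps [cur [flatE segs arcs [wr hd pos]]]] sc costs.
set v := iter i N u in sc; rewrite run_seq; set s1 := run append_vertex s.
have wr1 : writes s1 (path_code ps ++ (size cur).+1 :: [seq val x | x <- rcons cur v]).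
  have posE : size (path_code ps) + (size cur).+1 =
      size (path_code ps ++ size cur :: [seq val x | x <- cur]).
    by rewrite size_cat /= size_map.
  have headE : arr s aIn (size (path_code ps)) = size cur.
    by rewrite wr -?posE ?nth_cat ?ltnn ?subnn // addnS ltnS leq_addr.
  have := writes_append (v := val v) wr; rewrite -posE rcons_cat rcons_cons -map_rcons.
  move/(writes_update (v := (size cur).+1)).
  set L := path_code ps in hd pos headE *.
  have hp : (size L == size L + (size cur).+1) = false by lia.
  by rewrite /s1 /append_vertex !run_seq /= sc pos hd hp headE !addn1.
have hd1 : reg s1 rHead = size (path_code ps) by rewrite reg_run.
have pos1 : reg s1 rPos = size (path_code ps) + (size cur).+2.
  by rewrite [LHS]/= pos addn1 !addnS.
have flatS : flatten [seq P.1 :: P.2 | P <- ps] ++ rcons cur v = traject N u i.+1.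
  by rewrite trajectSr -flatE rcons_cat.
have cost1 : arr s1 aCost (reg s1 rCur) = cost D v (N v).
  by rewrite /s1 reg_run // arr_run // sc costs.
clearbody s1.
have -> : run (FIf (Equal (Get aCost (Reg rCur)) (Const 0)) FSkip open_path) s1 =
    if D v (N v) then s1 else run open_path s1.
  by rewrite run_if -[eval_test _ _]/(arr s1 aCost (reg s1 rCur) == 0) cost1 cost_eq0.
case: ifP => [Dv|/negbT nDv].
  exists ps, (rcons cur v); split=> //; first by rewrite all_rcons Dv.
  by rewrite size_rcons.
pose P := (head v cur, behead (rcons cur v)).
have PE : P.1 :: P.2 = rcons cur v by rewrite /P /= -headI.
have sizeP : (size P.2).+1 = (size cur).+1 by rewrite -(size_rcons cur v) -PE.
have codeP : path_code (rcons ps P) =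
    path_code ps ++ (size cur).+1 :: [seq val x | x <- rcons cur v].
  by rewrite path_code_rcons sizeP PE.
exists (rcons ps P), [::]; split=> //.
- by rewrite map_rcons flatten_rcons cats0 PE.
- rewrite all_rcons segs andbT /maximal_segment.
  have := lastI P.1 P.2; rewrite PE => /rcons_inj [<- <-].
  by rewrite nDv.
have size_code : size (path_code (rcons ps P)) = reg s1 rPos.
  by rewrite codeP size_cat pos1 /= size_map size_rcons.
split.
- have wrL : writes s1 (path_code (rcons ps P)) by rewrite codeP.
  by have := writes_append (v := 0) wrL; rewrite size_code -cats1.
- by rewrite size_code.
- by rewrite size_code.
Qed.

(** As [x] has no arc to [N x], starting at [N x] makes the last path end exactly at [x]. *)
Lemma run_write_paths st (x : 'I_n) (s : nat) (S : digraph 'I_s) f :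
  extended_semicomplete D S f ->
  (forall M, perm_cost D N <= perm_cost D M) ->
  (forall y, y \in porbit N (N x)) ->
  stores D st N -> (forall y : 'I_n, arr st aCost y = cost D y (N y)) ->
  reg st rFree = x.+1 -> ~~ D x (N x) ->
  exists2 G, output (run write_paths st) = encode_answer (Some G)
    & max_spanning_gcycle D f G.
Proof.
move=> extD optN ham [st_st nx] costs free nD.
rewrite /write_paths 5!run_seq.
set s0 := run (FAssign rCur _) _; set loop := FFor _ _ _.
pose P i s := [/\ forall y : 'I_n, arr s aNext y = N y,
  forall y : 'I_n, arr s aCost y = cost D y (N y),
  reg s rCur = iter i N (N x) & writing i (N x) s].
have [_ _ _ [ps [cur [flatE segs arcs [wr hd pos]]]]] : P n (run loop s0).
  apply: (for_ordinals (n := n)) => //; first exact: static_n st_st.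
    split=> //=; first by rewrite free subn1 nx.
    exists [::], [::]; split=> //; split=> //.
    by case=> [|[|k]].
  move=> y s' sy [nxs costs' sc wrs].
  have := writing_step wrs sc costs'; set step := (append_vertex ;; _) => wr1.
  rewrite -[run _ s']/(run (FAssign rCur (Get aNext (Reg rCur))) (run step s')).
  have nx1 (w : 'I_n) : arr (run step s') aNext w = N w by rewrite arr_run.
  have costs1 (w : 'I_n) : arr (run step s') aCost w = cost D w (N w) by rewrite arr_run.
  have sc1 : reg (run step s') rCur = iter y N (N x) by rewrite reg_run.
  move: (run step s') => s1 in wr1 nx1 costs1 sc1 *.
  by split=> //=; rewrite sc1 nx1.
have n_gt0 : 0 < n := leq_ltn_trans (leq0n x) (ltn_ord x).
have last_x : iter n.-1 N (N x) = x.
  apply: (@perm_inj _ N); rewrite -iterS prednK //.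
  by have := iter_card ham; rewrite card_ord.
(* The last vertex written is [x], whereas every vertex of an open path has an arc to its
   successor. *)
have curE : cur = [::].
  case/lastP: cur flatE arcs {wr pos} => // cur v.
  have -> : traject N (N x) n = rcons (traject N (N x) n.-1) x.
    by have := trajectSr N (N x) n.-1; rewrite last_x prednK.
  by rewrite -rcons_cat => /rcons_inj [_ ->]; rewrite all_rcons (negbTE nD).
rewrite {}curE cats0 in flatE wr pos.
exists (Paths ps).
  (* The subtraction drops the header 0 of the empty open path. *)
  rewrite output_assign -[eval _ _]/(reg (run loop s0) rPos - 1) pos addn1 subn1 /=.
  apply: (@eq_from_nth _ 0) => [|k]; first by rewrite size_mkseq.
  rewrite size_mkseq => lt_k; rewrite nth_mkseq // wr ?nth_cat ?lt_k //.
  by rewrite size_cat addn1 ltnW.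
apply: (paths_answer extD ham optN) => //.
by rewrite flatE card_ord.
Qed.

End OutputVerification.

(** * The algorithm *)

Lemma nth_allpairs (A B T : Type) (f : A -> B -> T) (s : seq A) (t : seq B) d a b i j :
  i < size s -> j < size t ->
  nth d [seq f x y | x <- s, y <- t] (i * size t + j) = f (nth a s i) (nth b t j).
Proof.
move=> + lt_j; elim: s i => //= x s IH [|i] lt_i.
  by rewrite nth_cat size_map lt_j (nth_map b).
rewrite nth_cat size_map mulSn -addnA addKn ltnNge leq_addr /=.
exact: IH.
Qed.

Lemma nth_encode_digraph n (D : digraph 'I_n) (x y : 'I_n) :
  nth 0 (encode_digraph D) ((x * n).+1 + y) = D x y.
Proof.
rewrite /encode_digraph addSn /= -[n in _ * n](size_enum_ord n).
by rewrite (nth_allpairs _ _ x x) ?size_enum_ord // !nth_ord_enum.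
Qed.

(** Kept outside [main], since a well-formed [fprog] never assigns the loop bounds [rN] and [rQ]. *)
Definition prologue : cmd :=
  Seq (Assign rN (Get aIn (Const 0))) (Assign rQ (Add (Reg rN) (Const 1))).

Definition prologue_state (w : seq nat) : state :=
  let st := set_reg (initial w) rN (arr (initial w) aIn 0) in
  set_reg st rQ (reg st rN + 1).

Lemma exec_prologue w : exec prologue (initial w) (prologue_state w) 7.
Proof. exact: (ExecSeq (ExecAssign _ _ _) (ExecAssign _ _ _)). Qed.

Section MainVerification.
Variables (n : nat) (D : digraph 'I_n).

Let st0 := prologue_state (encode_digraph D).

Lemma run_setup : static D (run setup st0).
Proof.
rewrite /setup !run_seq; set s0 := run _ st0; set loop := FFor _ _ _.
pose P i s := reg s rN = n /\ forall x, x <= i -> arr s aRow x = (x * n).+1.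
have [sn row] : P n (run loop s0).
  apply: (for_ordinals (n := n)) => //.
    by split=> // -[|x].
  move=> x s sx [sn row]; split=> // y; rewrite /= sx addn1 leq_eqVlt.
  case: eqVneq => [-> _|_ /= lt_y]; last exact: row.
  by rewrite row // sn mulSn addSn addnC.
have sq : reg (run loop s0) rQ = n.+1 by rewrite reg_run //= addn1.
have arcs (x y : 'I_n) : arr (run loop s0) aIn ((x * n).+1 + y) = D x y.
  by rewrite arr_run // -nth_encode_digraph.
move: (run loop s0) => s2 in sn row sq arcs *.
by split=> //=; rewrite sn row //; lia.
Qed.

Lemma run_main (s : nat) (S : digraph 'I_s) (f : 'I_n -> 'I_s) :
  extended_semicomplete D S f -> strongly_connected D ->
  exists2 a, output (run main st0) = encode_answer a & correct_answer D f a.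
Proof.
move=> extD strD; rewrite /main run_if -[eval_test _ _]/(n == 0).
case: eqVneq => [n0|]; last rewrite -lt0n => n_gt0.
  exists None; last first.
    have no (x : 'I_n) : False by have := ltn_ord x; rewrite [X in _ < X]n0.
    by case=> G [[_ HG] _]; case: G HG => [[|x c]|[|[x p] ps]] [] //; case: (no x).
  have size1 : size (encode_digraph D) = 1.
    by rewrite /= size_allpairs size_enum_ord n0.
  rewrite -[LHS]/(mkseq (arr st0 aIn) (size (encode_digraph D))) size1.
  by rewrite -[LHS]/[:: n] n0.
rewrite 4!run_seq.
set s1 := run setup st0; have sta1 : static D s1 := run_setup.
have [a i a_ge2|N [sto2 optN]] := run_auction sta1.
  rewrite arr_run; first by case: a a_ge2 => [|[|a]].
  by case: a a_ge2 => [|[|a]].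
pose z := Ordinal n_gt0.
have [M [sto3 leM orbM]] := @run_merge_cycles n D z erefl _ _ _ _ _ extD strD sto2.
have optM L : perm_cost D M <= perm_cost D L := leq_trans leM (optN L).
have [costs free] := run_find_free sto3.
have := stores_run (c := find_free) isT isT sto3.
move: (run find_free _) costs free => s4 costs free sto4.
rewrite run_if -[eval_test _ _]/(reg s4 rFree == 0).
case: free => [[-> all_arcs]|[x [r4 nDx]]].
  exists (Some (Cycle (traject M z n))); first exact: run_write_cycle sto4.
  by have := cycle_answer extD orbM all_arcs; rewrite card_ord.
rewrite r4 /=.
have [y|G outG maxG] := run_write_paths extD optM _ sto4 costs r4 nDx.
  by rewrite porbit_sym perm_in_porbit; have := orbM x;
    rewrite -eq_porbit_mem => /eqP xz; rewrite porbit_sym xz.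
by exists (Some G).
Qed.

End MainVerification.

Theorem theorem6p4 :
  exists (prog : cmd) (c k : nat),
    forall (n : nat) (D : digraph 'I_n)
           (s : nat) (S : digraph 'I_s) (f : 'I_n -> 'I_s),
      extended_semicomplete D S f ->
      strongly_connected D ->
      exists (st : state) (t : nat) (a : option (gcycle 'I_n)),
        [/\ exec prog (initial (encode_digraph D)) st t,
            t <= c * n ^ k + c,
            output st = encode_answer a
          & correct_answer D f a].
Proof.
have [K [k time_main]] := time_poly main.
(* [main] takes at most [K * (n + 1) ^ k] steps, and [n + 1 <= 2 * n] for [n > 0]. The prologue
   takes 7 steps; for [n = 0] the additive constant suffices. *)
exists (Seq prologue (compile main)), (K * 2 ^ k + 7), k => n D s S f extD strD.
have [a out_a correct_a] := run_main extD strD.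
have [//| r rb|t E le_t] := @exec_compile main (prologue_state (encode_digraph D)) n.+1.
  by move: rb; rewrite !inE => /orP [] /eqP -> /=; lia.
exists (run main (prologue_state (encode_digraph D))), (7 + t), a; split=> //.
  exact: ExecSeq (exec_prologue _) E.
have {le_t} le_t := leq_trans le_t (time_main n.+1 isT).
case: n => [|n] in le_t {D f extD strD a out_a correct_a E} *.
  apply: leq_trans (_ : _ <= K * 2 ^ k + 7) _; last exact: leq_addl.
  rewrite addnC leq_add2r (leq_trans le_t) // leq_mul2l orbC.
  by rewrite exp1n expn_gt0.
have: n.+2 ^ k <= 2 ^ k * n.+1 ^ k.
  by rewrite -expnMn; case: (k) => // k'; rewrite leq_exp2r //; lia.
have: 0 < n.+1 ^ k by rewrite expn_gt0.
move: (n.+2 ^ k) (n.+1 ^ k) (2 ^ k) le_t => A B C; nia.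
Qed.
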